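(* Let $k$ be a field. The face semigroup algebra $k\mathcal F$ of a central hyperplane arrangement depends only on the intersection lattice $\mathcal L$. That is, if $\mathcal A$ and $\mathcal A'$ are finite sets of hyperplanes through the origin (in $\mathbb R^d$ and $\mathbb R^{d'}$ respectively) whose intersection lattices $\mathcal L$ and $\mathcal L'$ are isomorphic, then their face semigroup algebras $k\mathcal F$ and $k\mathcal F'$ are isomorphic as $k$-algebras.
   Context: For an arrangement $\mathcal A$, for each $H\in\mathcal A$ fix a labelling $H^+,H^-$ of the two open half-spaces determined by $H$, and put $H^0=H$. A face of $\mathcal A$ is a nonempty set of the form $x=\bigcap_{H\in\mathcal A}H^{\sigma_H}$ with $\sigma_H\in\{+,-,0\}$; write $\sigma_H(x)=\sigma_H$. $\mathcal F$ is the set of faces. The support of a face is $\operatorname{supp}(x)=\bigcap_{H:\sigma_H(x)=0}H$ (equal to the ambient space if no $\sigma_H(x)$ is $0$). The intersection lattice $\mathcal L=\operatorname{supp}(\mathcal F)$ (equivalently, the set of intersections of subsets of $\mathcal A$) is ordered by inclusion. The product $xy$ of faces is the face with $\sigma_H(xy)=\sigma_H(x)$ if $\sigma_H(x)\ne0$ and $\sigma_H(xy)=\sigma_H(y)$ if $\sigma_H(x)=0$. This makes $\mathcal F$ a semigroup with identity $1=\bigcap_{H\in\mathcal A}H$, and the face semigroup algebra $k\mathcal F$ is its semigroup algebra over $k$. *)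

(* Defs.v *)
From HB Require Import structures.
From mathcomp Require Import all_boot all_order all_algebra.
From mathcomp Require Import finmap.
From mathcomp Require Import boolp reals.
From mathcomp Require Export monalg.

Set Implicit Arguments.
Unset Strict Implicit.
Unset Printing Implicit Defensive.

Import Order.TTheory GRing.Theory Num.Theory.
Local Open Scope ring_scope.

(* [form] carries the labelling of the half-spaces: [H^+] is the half-space
   where [form H] is positive.  Every labelling arises in this way (choose the
   sign of a linear form with kernel H), and only the signs of the forms matter
   below. *)
Record arrangement (R : realType) (d : nat) := Arrangement {
  hyperplanes : {fset {vspace 'rV[R]_d}};
  hyperplane_codim1 : forall H : hyperplanes, (\dim (val H)).+1 = d;
  form : hyperplanes -> 'Hom('rV[R]_d, R^o);
  form_kernel : forall H : hyperplanes, lker (form H) = val H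
}.

(* [None] is 0, [Some true] is +, [Some false] is -. *)
Notation sign := (option bool).

Section Faces.
Context {R : realType} {d : nat} (A : arrangement R d).
Implicit Types (H : hyperplanes A) (v w : 'rV[R]_d).

Definition half H (s : sign) : pred 'rV[R]_d := fun v =>
  match s with
  | None => v \in val H
  | Some true => (0 : R) < form H v
  | Some false => form H v < (0 : R)
  end.

Definition cell (s : {ffun hyperplanes A -> sign}) : pred 'rV[R]_d :=
  fun v => [forall H, half H (s H) v].

(* A face is represented by its sign vector; by [cell_inj] a nonempty set
   [cell s] determines [s], so these are exactly the nonempty cells. *)
Record face : predArgType := Face {
  face_sign :> {ffun hyperplanes A -> sign};
  face_nonempty : `[< exists v, cell face_sign v >]
}.
HB.instance Definition _ := [isSub for face_sign].
HB.instance Definition _ := [Finite of face by <:].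

Lemma half_inj H s t v : half H s v -> half H t v -> s = t.
Proof.
rewrite /half -form_kernel memv_ker.
case: s t => [[]|] [[]|] //=.
- by move=> /lt_trans h /h; rewrite ltxx.
- by move=> h /eqP e; move: h; rewrite e ltxx.
- by move=> h /(lt_trans h); rewrite ltxx.
- by move=> h /eqP e; move: h; rewrite e ltxx.
- by move=> /eqP ->; rewrite ltxx.
- by move=> /eqP ->; rewrite ltxx.
Qed.

Lemma cell_inj s t v : cell s v -> cell t v -> s = t.
Proof.
move=> /forallP hs /forallP ht; apply/ffunP => H; exact: half_inj (hs H) (ht H).
Qed.

Definition mulsign (s t : {ffun hyperplanes A -> sign}) :
    {ffun hyperplanes A -> sign} :=
  [ffun H => if s H == None then t H else s H].

Lemma mulsign_cell s t v w : cell s v -> cell t w ->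
  exists u, cell (mulsign s t) u.
Proof.
move=> /forallP sv /forallP tw.
have [e e0 he] : exists2 e : R, 0 < e &
    forall H, s H != None -> e * `|form H w : R| < `|form H v : R|.
  suff [e e0 he] : exists2 e : R, 0 < e & forall H, H \in enum {: hyperplanes A} ->
      s H != None -> e * `|form H w : R| < `|form H v : R|.
    by exists e => // H; apply: he; rewrite mem_enum.
  elim: (enum _) => [|H l [e e0 he]]; first by exists 1.
  have [e' e'0 he'] : exists2 e' : R, 0 < e' &
      (s H != None -> e' * `|form H w : R| < `|form H v : R|).
    have [sH|sH] := eqVneq (s H) None; first by exists 1.
    have v0 : 0 < `|form H v : R|.
      rewrite normr_gt0; apply: contra sH => /eqP v0.
      apply/eqP; apply: (half_inj (sv H)).
      by rewrite /half -form_kernel memv_ker; apply/eqP.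
    exists (`|form H v : R| / (1 + `|form H w : R|)).
      by rewrite divr_gt0 // ltr_pwDl.
    move=> _; rewrite -mulrA gtr_pMr // ltr_pdivrMl ?mulr1 ?ltr_pwDl //.
  exists (Num.min e e') => [|K]; first by rewrite lt_min e0.
  rewrite inE => /orP[/eqP->|Kl] sK.
    apply: le_lt_trans (he' sK); apply: ler_wpM2r => //.
    by rewrite ge_min lexx orbT.
  apply: le_lt_trans (he K Kl sK); apply: ler_wpM2r => //.
  by rewrite ge_min lexx.
exists (v + e *: w); apply/forallP => H; rewrite ffunE.
have := sv H; have := tw H; have := he H.
rewrite /half -form_kernel !memv_ker linearD linearZ /=.
set x : R := form H v; set y : R := form H w.
have -> : form H v + e *: form H w = x + e * y :> R by [].
case: (s H) => [b|] //=.
  move=> /(_ isT) + _; case: b => lexy.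
    move=> x0; move: lexy; rewrite (gtr0_norm x0) => lexy.
    rewrite -[X in X < _](subrr x) ltrD2l ltrNl.
    apply: le_lt_trans lexy; rewrite -mulrN; apply: ler_wpM2l; first exact: ltW.
    by rewrite -normrN ler_norm.
  move=> x0; move: lexy; rewrite (ltr0_norm x0) => lexy.
  rewrite -[X in _ < X](subrr x) ltrD2l.
  apply: le_lt_trans lexy; apply: ler_wpM2l; [exact: ltW | exact: ler_norm].
move=> _ tw0 /eqP x0; move: tw0; have -> : x = 0 by [].
case: (t H) => [[]|]; rewrite add0r.
- by rewrite pmulr_rgt0.
- by rewrite pmulr_rlt0.
- by rewrite mulf_eq0 (gt_eqF e0).
Qed.

Fact mulface_subproof (x y : face) : `[< exists v, cell (mulsign x y) v >].
Proof.
have /asboolP[v xv] := face_nonempty x; have /asboolP[w yw] := face_nonempty y.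
by apply/asboolP; apply: mulsign_cell xv yw.
Qed.
Definition mulface (x y : face) : face := Face (mulface_subproof x y).

Fact oneface_subproof : `[< exists v, cell [ffun=> None] v >].
Proof.
by apply/asboolP; exists 0; apply/forallP => H; rewrite ffunE /= mem0v.
Qed.
Definition oneface : face := Face oneface_subproof.

Fact mulfaceA : associative mulface.
Proof.
move=> x y z; apply/val_inj/ffunP => H; rewrite !ffunE.
by case: (x H).
Qed.

Fact mul1face : left_id oneface mulface.
Proof. by move=> x; apply/val_inj/ffunP => H; rewrite !ffunE eqxx. Qed.

Fact mulface1 : right_id oneface mulface.
Proof.
by move=> x; apply/val_inj/ffunP => H; rewrite !ffunE; case: eqP => [->|].
Qed.

Fact unitface (x y : face) : mulface x y = oneface -> x = oneface /\ y = oneface.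
Proof.
move=> /(congr1 val)/ffunP /= h.
suff -> : x = oneface.
  split=> //; apply/val_inj/ffunP => H; have := h H; rewrite !ffunE.
  by case: eqP => // ->.
by apply/val_inj/ffunP => H; have := h H; rewrite !ffunE; case: eqP.
Qed.

(* With this instance, the semigroup algebra of the faces over [k] is
   [{malg k[face A]}]. *)
HB.instance Definition _ :=
  Choice_isMonomialDef.Build face mulfaceA mul1face mulface1 unitface.

Definition supp (x : face) : {vspace 'rV[R]_d} :=
  (\bigcap_(H : hyperplanes A | x H == None) val H)%VS.

Definition intersection_lattice : finType := seq_sub (codom supp).

End Faces.

Definition lattice_isomorphic (R : realType) (d d' : nat)
    (A : arrangement R d) (A' : arrangement R d') : Prop :=
  exists2 phi : intersection_lattice A -> intersection_lattice A',
    bijective phi &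
    forall X Y, (val (phi X) <= val (phi Y))%VS = (val X <= val Y)%VS.

Definition algebra_isomorphic (k : fieldType) (B B' : lalgType k) : Prop :=
  exists f : {lrmorphism B -> B'}, bijective f.

(* Main.v *)
From HB Require Import structures.
Require Import Defs.
From mathcomp Require Import all_boot all_order all_algebra reals.
From mathcomp Require Import finmap boolp ring.

Set Implicit Arguments.
Unset Strict Implicit.
Unset Printing Implicit Defensive.

(* [form] is to denote the form attached to a hyperplane, not a sesquilinear form. *)
Import Defs.
Import Order.TTheory GRing.Theory Num.Theory.
Local Open Scope ring_scope.

(** Call the elements of the intersection lattice flats, and say that a flat [Y]
    covers a flat [Z] if it is a next larger one.  Let [M] be the vector space
    spanned by the faces, graded by their supports: [M] is the direct sum of its
    parts [M_Y], one for each flat [Y].  A face [x] acts on [M] by [x . y = xy]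
    if [supp x <= supp y], and [x . y = 0] otherwise; this respects the grading.
    Choose a face [l_Y] in each flat [Y].  Then [u |-> u . (sum of the l_Y)] is
    unitriangular with respect to dimension ([act_gens_triangular]), so [M] is a
    free [kF]-module of rank one, and [kF] can be recovered from [M] as the
    opposite of its ring of endomorphisms.  It is therefore enough to describe
    the module [M] and its endomorphisms in terms of the lattice.

    Besides the projections on the parts, the only endomorphism needed is the
    coboundary [d], which sends a face [z] to the sum, with signs, of the faces
    [y] that have [z] in their closure and whose support covers [supp z].  Each
    flat that covers [supp z] contains two such faces, one on each side of [z],
    and they get opposite signs.  If [x] is a face with [supp x] not inside
    [supp z], then multiplication by [x] identifies the two, which is why [d]
    commutes with the action ([act_diff]).  Three facts determine [M]:
    - [d^2 = 0] ([incidence_square]);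
    - [M_Y] is the direct sum of the line through [l_Y] and of the image of [d]
      in [M_Y]: the faces in [Y] are connected through walls ([connected]), and
      the coefficients of a coboundary in [M_Y] add up to zero;
    - if [d c] has no component in [M_Y], then the components of [c] in the flats
      covered by [Y] are those of a coboundary ([exactness]).
    By induction on [Y], they present [M] by the generators [l_Y] under the
    operator [d], with [d^2 = 0] as the only relation; this is a presentation of
    [kF] by the Hasse diagram of the lattice with relations of degree two.  For
    two arrangements with the same lattice, the smallest linear relation between
    [M] and [M'] that matches [l_Y] with [l'_Y] and is stable under the
    operators is then the graph of an isomorphism ([matching_total],
    [matching_eq0]), and it carries the algebra structure along
    ([quadratic_module_iso]).

    The signs of [d] come from orientations of the flats, given by a sequence of
    generic linear forms the first [r] of which restrict to coordinates on every
    flat of dimension [r].  The form [orient Z Y] compares the orientations of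
    [Z] and [Y]; for flats [W], [Z], [Y] of consecutive dimensions, the product of
    [orient W Z] and [orient Z Y] is a two by two determinant [wedge W Y] that
    does not depend on [Z] ([orientM]), and between a face [w] and a face [y] of
    codimension two over it there are exactly two faces, for which this
    determinant has opposite signs.

    Exactness is proved inside a convex region, cut out by prescribing some of
    the signs.  If a cycle meets a hyperplane [H], its total flux across [H] is
    zero, so connectedness of the trace of the region on [H] provides a
    coboundary that cancels the part of the cycle on [H]; what remains splits
    into a cycle on each side of [H], and one more sign is prescribed. *)

(** * Algebras that act freely on a module with quadratic relations *)

(** For the faces, [l Y] is a face of support [Y], [pr] is the projection on a
    part and [d] the coboundary.  [d_exact] says that all relations between the
    [l Y] follow from [d_d]. *)
Record quadratic (k : fieldType) (L : finType) (cov : rel L) (M : lmodType k)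
    (pr : L -> {linear M -> M}) (d : {linear M -> M}) (l : L -> M) : Prop :=
  Quadratic {
  pr_pr : forall X Y m, pr X (pr Y m) = if X == Y then pr X m else 0;
  sum_pr : forall m, m = \sum_X pr X m;
  pr_gen : forall X Y, pr X (l Y) = if X == Y then l X else 0;
  pr_d_pr : forall Y Z m, ~~ cov Z Y -> pr Y (d (pr Z m)) = 0;
  d_d : forall m, d (d m) = 0;
  d_exact : forall Y c, pr Y (d c) = 0 ->
    exists w, forall Z, cov Z Y -> pr Z c = pr Z (d w);
  d_span : forall Y m, exists a c, pr Y m = a *: l Y + pr Y (d c);
  d_free : forall Y a c, a *: l Y + pr Y (d c) = 0 -> a = 0
}.

Section QuadraticTheory.
Variables (k : fieldType) (L : finType) (cov : rel L) (rk : L -> nat).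
Hypothesis cov_rk : forall X Y, cov X Y -> (rk X < rk Y)%N.

Lemma cov_ind (P : L -> Prop) :
  (forall Y, (forall Z, cov Z Y -> P Z) -> P Y) -> forall Y, P Y.
Proof.
move=> h Y; have [n] := ubnP (rk Y).
elim: n Y => // n ih Y; rewrite ltnS => le; apply: h => Z /cov_rk ltZ.
exact/ih/(leq_trans ltZ).
Qed.

Section One.
Variables (M : lmodType k) (pr : L -> {linear M -> M}) (d : {linear M -> M}).
Variable (l : L -> M).
Hypothesis qM : quadratic cov pr d l.

Lemma pr_dE Y c : pr Y (d c) = \sum_(Z | cov Z Y) pr Y (d (pr Z c)).
Proof.
rewrite {1}(sum_pr qM c) !linear_sum (bigID (fun Z => cov Z Y)) /=.
by rewrite [X in _ + X]big1 ?addr0 // => Z nc; exact: (pr_d_pr qM).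
Qed.

(** The generators [l X] produce the whole module under the operators: by
    [d_span], what is left of [pr Y m] comes from the flats covered by [Y]. *)
Lemma quadratic_ind (P : M -> Prop) :
  P 0 -> (forall a m n, P m -> P n -> P (a *: m + n)) ->
  (forall X, P (l X)) -> (forall m, P m -> P (d m)) ->
  (forall X m, P m -> P (pr X m)) -> forall m, P m.
Proof.
move=> P0 PD Pl Pd Ppr m.
have Psum (r : seq L) (A : pred L) F : (forall X, A X -> P (F X)) ->
    P (\sum_(X <- r | A X) F X).
  move=> h; apply: big_ind => // x y Px Py.
  by rewrite -[x]scale1r; apply: PD.
rewrite (sum_pr qM m); apply: (Psum) => Y _.
elim/cov_ind: Y m => Y ih m.
have [a [c ->]] := d_span qM Y m.
apply: PD => //; rewrite pr_dE; apply: (Psum) => Z /ih PZ.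
exact/Ppr/Pd/PZ.
Qed.

End One.

Section Two.
Variables (M M' : lmodType k).
Variables (pr : L -> {linear M -> M}) (d : {linear M -> M}) (l : L -> M).
Variables (pr' : L -> {linear M' -> M'}) (d' : {linear M' -> M'}) (l' : L -> M').

(** The smallest candidate for the graph of an isomorphism that sends [l X] to
    [l' X] and commutes with the operators. *)
Inductive matching : M -> M' -> Prop :=
| matching0 : matching 0 0
| matching_comb a m m' n n' : matching m m' -> matching n n' ->
    matching (a *: m + n) (a *: m' + n')
| matching_gen X : matching (l X) (l' X)
| matching_d m m' : matching m m' -> matching (d m) (d' m')
| matching_pr X m m' : matching m m' -> matching (pr X m) (pr' X m').

End Two.

Lemma matching_sym M M' pr d l pr' d' l' m m' :
  @matching M M' pr d l pr' d' l' m m' ->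
  @matching M' M pr' d' l' pr d l m' m.
Proof. by elim=> *; constructor. Qed.

Section Functional.
Variables (M M' : lmodType k).
Variables (pr : L -> {linear M -> M}) (d : {linear M -> M}) (l : L -> M).
Variables (pr' : L -> {linear M' -> M'}) (d' : {linear M' -> M'}) (l' : L -> M').
Hypothesis qM : quadratic cov pr d l.
Hypothesis qM' : quadratic cov pr' d' l'.
Local Notation matching := (matching pr d l pr' d' l').

Lemma matching_total m : exists m', matching m m'.
Proof.
elim/(quadratic_ind qM): m.
- by exists 0; constructor.
- by move=> a m n [m' mm'] [n' nn']; exists (a *: m' + n'); constructor.
- by move=> X; exists (l' X); constructor.
- by move=> m [m' mm']; exists (d' m'); constructor.
- by move=> X m [m' mm']; exists (pr' X m'); constructor.
Qed.

(** A decomposition as in [d_span] can be taken simultaneously for both sides,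
    with the same scalar. *)
Lemma matching_split m m' : matching m m' -> forall Y, exists a c c',
  [/\ matching c c', pr Y m = a *: l Y + pr Y (d c)
    & pr' Y m' = a *: l' Y + pr' Y (d' c')].
Proof.
elim=> [|a {}m {}m' n n' _ ihm _ ihn|X|{}m {}m' mm' _|X {}m {}m' _ ih] Y.
- by exists 0, 0, 0; split; rewrite ?linear0 ?scale0r ?addr0 //; constructor.
- have [b [c [c' [cc' em em']]]] := ihm Y.
  have [b' [e [e' [ee' en en']]]] := ihn Y.
  exists (a * b + b'), (a *: c + e), (a *: c' + e').
  rewrite !linearP em em' en en' !scalerDr !scalerDl !scalerA.
  by split; [constructor | rewrite addrACA..].
- rewrite (pr_gen qM) (pr_gen qM'); exists (Y == X)%:R, 0, 0.
  split; first by constructor.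
    by rewrite !linear0 addr0; case: eqP => _; rewrite ?scale1r ?scale0r.
  by rewrite !linear0 addr0; case: eqP => _; rewrite ?scale1r ?scale0r.
- by exists 0, m, m'; rewrite !scale0r !add0r.
- rewrite (pr_pr qM) (pr_pr qM'); case: eqP => _; first exact: ih.
  by exists 0, 0, 0; split; rewrite ?linear0 ?scale0r ?addr0 //; constructor.
Qed.

(** This is where exactness on the left meets [d_d] on the right: if [pr Y m] is
    zero, the element [c] of [matching_split] agrees below [Y] with some [d w]; by
    induction its partner [c'] agrees there with [d' w'], and [d' (d' w') = 0]. *)
Lemma matching_pr_eq0 Y m m' : matching m m' -> pr Y m = 0 -> pr' Y m' = 0.
Proof.
elim/cov_ind: Y m m' => Y ih m m' mm' pm0.
have [a [c [c' [cc' em em']]]] := matching_split mm' Y.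
move: em; rewrite pm0 => /esym em.
have a0 := d_free qM em; rewrite em' a0 !scale0r !add0r in em *.
move/(d_exact qM): em => [w cw].
have [w' ww'] := matching_total w.
have cw' Z : cov Z Y -> pr' Z c' = pr' Z (d' w').
  move=> cZ; apply/subr0_eq; rewrite -linearB.
  apply: (ih Z cZ (- d w + c)); last by rewrite linearD linearN cw // addNr.
  rewrite [c' - _]addrC -!scaleN1r.
  by apply: matching_comb => //; apply: matching_d.
rewrite (pr_dE qM'); under eq_bigr => Z cZ do rewrite cw' //.
by rewrite -(pr_dE qM') (d_d qM') linear0.
Qed.

Lemma matching_eq0 m' : matching 0 m' -> m' = 0.
Proof.
move=> m0; rewrite (sum_pr qM' m') big1 // => Y _.
apply: matching_pr_eq0 m0 _; exact: linear0.
Qed.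

End Functional.
End QuadraticTheory.

Lemma algebra_isomorphicI (k : fieldType) (B B' : lalgType k) (f : B -> B') :
  linear f -> monoid_morphism f -> bijective f -> algebra_isomorphic B B'.
Proof.
move=> lin_f mul_f bij_f.
pose lin := GRing.isLinear.Build k B B' *:%R f lin_f.
pose mul := GRing.isMonoidMorphism.Build B B' f mul_f.
pose F : {lrmorphism B -> B'} := HB.pack f lin mul.
by exists F.
Qed.

(** [qm_free] makes [M] a free module of rank one over [B], generated by the sum
    of the [qm_gen X]. *)
Record quadratic_module (k : fieldType) (L : finType) (cov : rel L)
    (B : lalgType k) (M : lmodType k) := QuadraticModule {
  qm_pr : L -> {linear M -> M};
  qm_d : {linear M -> M};
  qm_gen : L -> M;
  qm_quadratic : quadratic cov qm_pr qm_d qm_gen;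
  qm_act : B -> {linear M -> M};
  qm_actP : forall a u v m, qm_act (a *: u + v) m = a *: qm_act u m + qm_act v m;
  qm_act1 : forall m, qm_act 1 m = m;
  qm_actM : forall u v m, qm_act (u * v) m = qm_act u (qm_act v m);
  qm_act_pr : forall u X m, qm_act u (qm_pr X m) = qm_pr X (qm_act u m);
  qm_act_d : forall u m, qm_act u (qm_d m) = qm_d (qm_act u m);
  qm_free : bijective (fun u => qm_act u (\sum_X qm_gen X))
}.

Section Isomorphism.
Variables (k : fieldType) (L : finType) (cov : rel L) (rk : L -> nat).
Hypothesis cov_rk : forall X Y, cov X Y -> (rk X < rk Y)%N.
Variables (B B' : lalgType k) (M M' : lmodType k).

Section OneWay.
Variables (Q : quadratic_module cov B M) (Q' : quadratic_module cov B' M').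

Local Notation matching :=
  (matching (qm_pr Q) (qm_d Q) (qm_gen Q) (qm_pr Q') (qm_d Q') (qm_gen Q')).

(** [u] and [u'] are identified with elements of [M] and [M'] through the
    generators of these free modules. *)
Definition partner u u' :=
  matching (qm_act Q u (\sum_X qm_gen Q X)) (qm_act Q' u' (\sum_X qm_gen Q' X)).

Lemma partner_total u : exists u', partner u u'.
Proof.
have [m' mm'] := matching_total cov_rk (qm_pr Q') (qm_d Q') (qm_gen Q')
  (qm_quadratic Q) (qm_act Q u (\sum_X qm_gen Q X)).
have [h' _ hK'] := qm_free Q'; exists (h' m').
by rewrite /partner hK'.
Qed.

Lemma partner_comb a u u' v v' :
  partner u u' -> partner v v' -> partner (a *: u + v) (a *: u' + v').
Proof.
by move=> uu' vv'; rewrite /partner !qm_actP; constructor.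
Qed.

Lemma partner1 : partner 1 1.
Proof.
rewrite /partner !qm_act1.
apply: (big_ind2 matching) => [|m m' n n' mm' nn'|X _]; try by constructor.
by rewrite -[m]scale1r -[m']scale1r; constructor.
Qed.

(** Projections commute with the action and send the generator of [M] to
    [qm_gen Q X]. *)
Lemma matching_gen_act u u' X :
  partner u u' -> matching (qm_act Q u (qm_gen Q X)) (qm_act Q' u' (qm_gen Q' X)).
Proof.
have gensum (C : lalgType k) (N : lmodType k) (S : quadratic_module cov C N) :
    qm_gen S X = qm_pr S X (\sum_Y qm_gen S Y).
  rewrite linear_sum (bigD1 X) //= (pr_gen (qm_quadratic S)) eqxx.
  rewrite big1 ?addr0 // => Y; rewrite eq_sym => /negbTE neYX.
  by rewrite (pr_gen (qm_quadratic S)) neYX.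
by move=> uu'; rewrite !gensum !qm_act_pr; constructor.
Qed.

(** An endomorphism of [M] commutes with the action, so it is enough to look at
    the generators [qm_gen Q X]; this yields multiplicativity. *)
Lemma matching_act u u' m m' : partner u u' -> matching m m' ->
  matching (qm_act Q u m) (qm_act Q' u' m').
Proof.
move=> uu'; elim=> [|a {}m {}m' n n' _ ihm _ ihn|X|{}m {}m' mm' ih|X {}m {}m' _ ih].
- by rewrite !linear0; constructor.
- by rewrite !linearP; constructor.
- exact: matching_gen_act.
- by rewrite !qm_act_d; constructor.
- by rewrite !qm_act_pr; constructor.
Qed.

Lemma partnerM u u' v v' : partner u u' -> partner v v' ->
  partner (u * v) (u' * v').
Proof.
by move=> uu' vv'; rewrite /partner !qm_actM; apply: matching_act.
Qed.

Lemma partner_inj u u1 u2 : partner u u1 -> partner u u2 -> u1 = u2.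
Proof.
move=> p1 p2; have [h' h'K _] := qm_free Q'.
have := partner_comb (-1) p1 p2.
rewrite /partner !qm_actP !scaleN1r addNr.
move/(matching_eq0 cov_rk (qm_quadratic Q) (qm_quadratic Q')).
rewrite addrC => /subr0_eq e.
by apply: (can_inj h'K); rewrite e.
Qed.

End OneWay.
End Isomorphism.

Lemma partner_sym (k : fieldType) (L : finType) (cov : rel L)
    (B B' : lalgType k) (M M' : lmodType k)
    (Q : quadratic_module cov B M) (Q' : quadratic_module cov B' M') u u' :
  partner Q Q' u u' -> partner Q' Q u' u.
Proof. exact: matching_sym. Qed.

Theorem quadratic_module_iso (k : fieldType) (L : finType) (cov : rel L)
    (rk : L -> nat) (cov_rk : forall X Y, cov X Y -> (rk X < rk Y)%N)
    (B B' : lalgType k) (M M' : lmodType k)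
    (Q : quadratic_module cov B M) (Q' : quadratic_module cov B' M') :
  algebra_isomorphic B B'.
Proof.
have [f fP] := choice (partner_total cov_rk Q Q').
have [g gP] := choice (partner_total cov_rk Q' Q).
have fE u u' : partner Q Q' u u' -> f u = u'.
  exact: (partner_inj cov_rk) (fP u).
apply: (algebra_isomorphicI (f := f)) => [a u v|| ].
- exact/fE/partner_comb.
- by split=> [|u v]; apply: fE; [apply: partner1 | apply: partnerM].
- exists g => [u|v]; last by apply: fE; apply/partner_sym/gP.
  by apply: (partner_inj cov_rk) (gP (f u)) _; apply/partner_sym/fP.
Qed.

Lemma quadratic_module_reindex (k : fieldType) (L L' : finType)
    (cov : rel L) (cov' : rel L') (phi : L -> L') (B : lalgType k) (M : lmodType k) :
  bijective phi -> (forall X Y, cov' (phi X) (phi Y) = cov X Y) ->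
  quadratic_module cov' B M -> quadratic_module cov B M.
Proof.
move=> bij_phi covE Q.
have inj_phi := bij_inj bij_phi.
have sumE (F : L' -> M) : \sum_X F (phi X) = \sum_X F X.
  by rewrite (reindex phi) //; apply: onW_bij.
apply: (@QuadraticModule k L cov B M (fun X => qm_pr Q (phi X)) (qm_d Q)
          (fun X => qm_gen Q (phi X)) _ (qm_act Q)).
- have q := qm_quadratic Q; split.
  + by move=> X Y m; rewrite (pr_pr q) (inj_eq inj_phi).
  + by move=> m; rewrite (sumE (fun X => qm_pr Q X m)) -(sum_pr q).
  + by move=> X Y; rewrite (pr_gen q) (inj_eq inj_phi).
  + by move=> Y Z m ncov; apply: (pr_d_pr q); rewrite covE.
  + exact: (d_d q).
  + move=> Y c /(d_exact q)[w wc]; exists w => Z cZY; apply: wc.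
    by rewrite covE.
  + by move=> Y; apply: (d_span q).
  + by move=> Y; apply: (d_free q).
- exact: qm_actP.
- exact: qm_act1.
- exact: qm_actM.
- by move=> u X; apply: qm_act_pr.
- exact: qm_act_d.
- by rewrite (sumE (qm_gen Q)); apply: qm_free.
Qed.

(** * Orientations from generic linear forms *)

Section Orientation.
Variables (R : realType) (d : nat).
Local Notation V := 'rV[R]_d.

Lemma exists_nonroot (p : {poly R}) : p != 0 -> exists t, p.[t] != 0.
Proof.
move=> p0; apply: contrapT => /forallNP h.
have := @max_poly_roots R p [seq i%:R | i <- iota 0 (size p)] p0.
rewrite size_map size_iota ltnn => roots; suff : false by [].
apply: roots.
  by apply/allP => _ /mapP[i _ ->]; apply/negPn/negP/h.
by rewrite map_inj_uniq ?iota_uniq // => i j /eqP; rewrite eqr_nat => /eqP.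
Qed.

(** Evaluate the coordinates as coefficients of a polynomial at a point that is a
    root of none of them. *)
Lemma exists_form_avoiding (s : seq V) :
  exists f : 'Hom(V, R^o), forall v, v \in s -> v != 0 -> f v != 0.
Proof.
have [|t pt] := @exists_nonroot (\prod_(v <- s | v != 0) rVpoly v).
  rewrite prodf_seq_neq0; apply/allP => v _; apply/implyP; apply: contra => /eqP v0.
  by rewrite -[v]rVpolyK v0 linear0.
pose ev (v : V) : R^o := (rVpoly v).[t].
have lin_ev : linear ev by move=> a u v; rewrite /ev linearP hornerD hornerZ.
pose F : {linear V -> R^o} := HB.pack ev (GRing.isLinear.Build R V R^o *:%R ev lin_ev).
exists (linfun F) => v vs v0; rewrite lfunE /= /ev.
by move: pt; rewrite horner_prod prodf_seq_neq0 => /allP/(_ v vs)/implyP; apply.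
Qed.

Variable S : seq {vspace V}.

Fact generic_form_subproof (K : {vspace V}) :
  exists f : 'Hom(V, R^o),
    forall X, X \in S -> vpick (X :&: K)%VS != 0 -> f (vpick (X :&: K)%VS) != 0.
Proof.
have [f fP] := exists_form_avoiding [seq vpick (X :&: K)%VS | X <- S].
by exists f => X XS; apply: fP; apply: (map_f (fun X => vpick (X :&: K)%VS)).
Qed.
(** It is nonzero at a vector of each nonzero [X :&: K], so that its kernel cuts the
    dimensions of all of them at once. *)
Definition generic_form K := sval (cid (generic_form_subproof K)).

Fixpoint flag (r : nat) : {vspace V} :=
  if r is r'.+1 then (flag r' :&: lker (generic_form (flag r')))%VS else fullv.

Definition flag_form r : 'Hom(V, R^o) := generic_form (flag r).

Lemma dim_cap_flag_ge X r : (\dim X <= \dim (X :&: flag r) + r)%N.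
Proof.
elim: r => [|r ih] /=; first by rewrite capvf addn0.
apply: leq_trans ih _; rewrite addnS -addSn leq_add2r.
rewrite capvA -(limg_ker_dim (flag_form r) (X :&: flag r)).
rewrite -[X in (_ <= X)%N]addn1 leq_add2l.
by rewrite (leq_trans (dimvS (subvf _))) // dimvf.
Qed.

Lemma dim_cap_flag_le X r : X \in S -> (\dim (X :&: flag r) <= \dim X - r)%N.
Proof.
move=> XS; elim: r => [|r ih] /=; first by rewrite capvf subn0.
have [X0|X0] := eqVneq (X :&: flag r)%VS 0%VS.
  by rewrite capvA X0 cap0v dimv0.
have : (\dim (X :&: flag r :&: lker (flag_form r)) < \dim (X :&: flag r))%N.
  rewrite ltnNge; apply/negP; rewrite (geq_leqif (dimv_leqif_sup (capvSl _ _))).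
  rewrite subv_cap subvv /= => /subvP/(_ _ (memv_pick _)).
  rewrite memv_ker; apply/negP.
  apply: (svalP (cid (generic_form_subproof (flag r)))) => //.
  by rewrite vpick0.
by rewrite capvA subnS => /leq_trans/(_ ih); case: (_ - _)%N.
Qed.

(** In other words, the first [r] generic forms are coordinates on the members of
    [S] of dimension [r]. *)
Lemma cap_flag0 X r : X \in S -> (\dim X <= r)%N -> (X :&: flag r = 0)%VS.
Proof.
move=> XS le; apply/eqP; rewrite -dimv_eq0 -leqn0.
by rewrite (leq_trans (dim_cap_flag_le r XS)) // leqn0 subn_eq0.
Qed.

(** The projection of [Y] along [X] on the slice where the first [\dim X] generic
    forms vanish. *)
Definition along X Y : 'End(V) := daddv_pi (Y :&: flag (\dim X)) X.

(** If [Y] covers [X], this is a form on [Y] with kernel [X]; it is the quotient of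
    the volume forms that the generic forms define on [Y] and on [X]. *)
Definition orient X Y : 'Hom(V, R^o) := (flag_form (\dim X) \o along X Y)%VF.

Section Pair.
Variables X Y : {vspace V}.
Hypotheses (XS : X \in S) (YS : Y \in S) (XY : (X <= Y)%VS).

Lemma cap_slice : (Y :&: flag (\dim X) :&: X = 0)%VS.
Proof.
apply/eqP; rewrite -subv0 -(cap_flag0 XS (leqnn _)) subv_cap capvSr.
by rewrite (subv_trans (capvSl _ _)) // capvSr.
Qed.

Lemma add_slice : (Y :&: flag (\dim X) + X = Y)%VS.
Proof.
apply/eqP; rewrite -(geq_leqif (dimv_leqif_eq _)); last first.
  by rewrite subv_add capvSl XY.
by rewrite dimv_disjoint_sum ?cap_slice // dim_cap_flag_ge.
Qed.

Lemma along_slice v : along X Y v \in (Y :&: flag (\dim X))%VS.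
Proof. exact: memv_pi. Qed.

Lemma along_in v : along X Y v \in Y.
Proof. by have := along_slice v; rewrite memv_cap => /andP[]. Qed.

Lemma along_flag v : along X Y v \in flag (\dim X).
Proof. by have := along_slice v; rewrite memv_cap => /andP[]. Qed.

Lemma along_id v : v \in (Y :&: flag (\dim X))%VS -> along X Y v = v.
Proof. exact: daddv_pi_id cap_slice. Qed.

Lemma sub_along v : v \in Y -> v - along X Y v \in X.
Proof.
rewrite -{1}add_slice => /(daddv_pi_add cap_slice) {1}<-.
by rewrite addrAC subrr add0r memv_pi.
Qed.

Lemma along0 v : v \in X -> along X Y v = 0.
Proof.
move=> vX; apply/eqP; rewrite -memv0 -cap_slice memv_cap along_slice /=.
rewrite -[along X Y v](subKr v) memvB // sub_along //.
exact: (subvP XY).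
Qed.

Lemma orient0 v : v \in X -> orient X Y v = 0.
Proof. by move=> vX; rewrite lfunE /= along0 ?linear0. Qed.

Lemma orient_eq0 v : (\dim Y <= (\dim X).+1)%N -> v \in Y -> orient X Y v = 0 ->
  v \in X.
Proof.
move=> dimY vY; rewrite lfunE /= => ov.
have := sub_along vY; suff -> : along X Y v = 0 by rewrite subr0.
apply/eqP; rewrite -memv0 -(cap_flag0 YS dimY) /= !memv_cap.
by rewrite along_in along_flag memv_ker; apply/eqP.
Qed.

(** The determinant of [u] and [v] in the plane [Y / X], when it is one. *)
Definition wedge u v : R :=
  flag_form (\dim X) (along X Y u) * flag_form (\dim X).+1 (along X Y v)
  - flag_form (\dim X) (along X Y v) * flag_form (\dim X).+1 (along X Y u).

Lemma wedgeC u v : wedge v u = - wedge u v.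
Proof. by rewrite opprB. Qed.

Lemma wedgeDl u u' v : wedge (u + u') v = wedge u v + wedge u' v.
Proof. by rewrite /wedge !linearD /=; ring. Qed.

Lemma wedgeZl c u v : wedge (c *: u) v = c * wedge u v.
Proof. by rewrite /wedge !linearZ /= /GRing.scale /=; ring. Qed.

Lemma wedge0 u v : u \in X -> wedge u v = 0.
Proof. by move=> uX; rewrite /wedge along0 // !linear0 mul0r mulr0 subrr. Qed.

(** Three vectors of a plane satisfy the identity of Cramer. *)
Lemma wedge_cramer u v w : (\dim Y <= (\dim X).+2)%N ->
    u \in Y -> v \in Y -> w \in Y ->
  wedge u w *: v - (wedge v w *: u + wedge u v *: w) \in X.
Proof.
move=> dimY uY vY wY; set e := _ - _.
have eY : e \in Y by rewrite memvB ?memvD ?memvZ.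
have := sub_along eY; suff -> : along X Y e = 0 by rewrite subr0.
apply/eqP; rewrite -memv0 -(cap_flag0 YS dimY) /= !memv_cap.
have fE (f : 'Hom(V, R^o)) : f (along X Y e) = wedge u w * f (along X Y v)
    - (wedge v w * f (along X Y u) + wedge u v * f (along X Y w)) :> R.
  rewrite /e (linearB (along X Y)) (linearD (along X Y)) !(linearZZ (along X Y)).
  by rewrite (linearB f) (linearD f) !(linearZZ f).
rewrite along_in along_flag !memv_ker !fE /wedge /flag_form /=.
by apply/andP; split; apply/eqP; ring.
Qed.

End Pair.

(** Let [P] be the projection along [W], and [a], [b] the two generic forms in the
    definition of [wedge].  The form [a] vanishes on [e = a u *: P v - a v *: P u],
    so [orient Z Y] takes the same value as [b] there, and this is the right side.
    As [e] and [a u *: v] agree modulo [Z], it is also the left side. *)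
Lemma orientM (W Z Y : {vspace V}) u v : W \in S -> Z \in S -> Y \in S ->
  (W <= Z)%VS -> (Z <= Y)%VS -> \dim Z = (\dim W).+1 ->
  u \in Z -> v \in Y ->
  (orient W Z u : R) * orient Z Y v = wedge W Y u v.
Proof.
move=> WS ZS YS WZ ZY dimZ uZ vY; have WY := subv_trans WZ ZY.
pose P := along W Y.
have PuZ : P u = along W Z u.
  have : P (u - along W Z u) = 0 by rewrite /P along0 ?sub_along.
  rewrite linearB /= => /subr0_eq ->.
  rewrite /P (@along_id W Y WS (along W Z u)) // memv_cap along_flag andbT.
  exact/(subvP ZY)/along_in.
pose a x : R := flag_form (\dim W) (P x); pose b x : R := flag_form (\dim W).+1 (P x).
have -> : orient W Z u = a u by rewrite lfunE /= /a PuZ.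
pose e := a u *: P v - a v *: P u.
have fE (f : 'Hom(V, R^o)) : f e = a u * f (P v) - a v * f (P u) :> R.
  by rewrite /e (linearB f) !(linearZZ f).
have eK : e \in flag (\dim Z).
  rewrite dimZ /= memv_cap memvB ?memvZ ?along_flag // memv_ker.
  by apply/eqP; rewrite fE /a mulrC subrr.
have eY : e \in Y by rewrite memvB ?memvZ ?along_in.
have oe : orient Z Y e = a u * b v - a v * b u :> R.
  rewrite lfunE /= along_id // ?memv_cap ?eY // dimZ.
  exact: fE.
have PvE : orient Z Y (P v) = orient Z Y v.
  have : orient Z Y (v - P v) = 0.
    by rewrite orient0 //; apply/(subvP WZ)/sub_along.
  by rewrite linearB /= => /subr0_eq ->.
rewrite /wedge -/P -/(a u) -/(a v) -/(b u) -/(b v) -oe.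
have Pu0 : orient Z Y (P u) = 0 by rewrite orient0 // PuZ along_in.
by rewrite fE PvE Pu0 mulr0 subr0.
Qed.

End Orientation.

(** * Faces, their supports and their products *)

Definition sgn (R : realType) (r : R) : sign :=
  if 0 < r then Some true else if r < 0 then Some false else None.

Section Sgn.
Variable R : realType.
Implicit Types a b s t : R.

Lemma sgn_None a : (sgn a == None) = (a == 0).
Proof. by rewrite /sgn; case: ltgtP. Qed.

Lemma sgn_true a : (sgn a == Some true) = (0 < a).
Proof. by rewrite /sgn; case: ltgtP. Qed.

Lemma sgn_false a : (sgn a == Some false) = (a < 0).
Proof. by rewrite /sgn; case: ltgtP. Qed.

Lemma sgn_pmul s a : 0 < s -> sgn (s * a) = sgn a.
Proof. by move=> s0; rewrite /sgn pmulr_rgt0 // pmulr_rlt0. Qed.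

Lemma sgnN a : sgn (- a) = omap negb (sgn a).
Proof. by rewrite /sgn oppr_gt0 oppr_lt0; case: ltgtP. Qed.

Lemma sgn_comb s t a b : 0 < s -> 0 < t -> sgn a = sgn b ->
  sgn (s * a + t * b) = sgn a.
Proof.
move=> s0 t0; rewrite /sgn.
case: (ltgtP 0 a) => a0; case: (ltgtP 0 b) => b0 //= _.
- by rewrite addr_gt0 // mulr_gt0.
- have n : s * a + t * b < 0.
    by rewrite -oppr_gt0 opprD -!mulrN addr_gt0 // mulr_gt0 ?oppr_gt0.
  by rewrite (lt_gtF n) n.
- by rewrite -a0 -b0 !mulr0 addr0 ltxx.
Qed.

(** If two points lie strictly on opposite sides of a hyperplane, then the segment
    between them crosses it. *)
Lemma sgn_eliminate a b : sgn a != None -> sgn b != None -> sgn a != sgn b ->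
  exists s t, [/\ 0 < s, 0 < t & s * a + t * b = 0].
Proof.
rewrite /sgn; case: (ltgtP 0 a) => a0; case: (ltgtP 0 b) => b0 //= _ _ _.
- by exists (- b), a; split; rewrite ?oppr_gt0 //; ring.
- by exists b, (- a); split; rewrite ?oppr_gt0 //; ring.
Qed.

Lemma sgn_mul_gt0 a b : sgn a = sgn b -> sgn a != None -> 0 < a * b.
Proof.
rewrite /sgn; case: (ltgtP 0 a) => a0; case: (ltgtP 0 b) => b0 //= _ _.
  by rewrite mulr_gt0.
by rewrite nmulr_rgt0.
Qed.

End Sgn.

(** On faces, [sign_le x y] means that [x] is contained in the closure of [y]. *)
Definition sign_le (T : finType) (s t : {ffun T -> sign}) :=
  [forall H, (s H != None) ==> (t H == s H)].

Lemma sign_leP (T : finType) (s t : {ffun T -> sign}) :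
  reflect (forall H, s H != None -> t H = s H) (sign_le s t).
Proof.
apply: (iffP forallP) => h H; first by move=> sH; have /implyP/(_ sH)/eqP := h H.
by apply/implyP => /h/eqP.
Qed.

Lemma sign_le_trans (T : finType) : transitive (@sign_le T).
Proof.
move=> t s u /sign_leP st /sign_leP tu; apply/sign_leP => H sH.
by rewrite tu st.
Qed.

Section Faces.
Context {R : realType} {d : nat} (A : arrangement R d).
Local Notation V := 'rV[R]_d.
Implicit Types (H K : hyperplanes A) (u v w : V) (x y z : face A).
Implicit Types (U W X Y Z : {vspace V}).

Lemma mem_hyperplane H v : (v \in val H) = (form H v == 0 :> R).
Proof. by rewrite -form_kernel memv_ker. Qed.

Definition sign_vector v : {ffun hyperplanes A -> sign} :=
  [ffun H => sgn (form H v : R)].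

Lemma half_sgn H s v : half H s v = (s == sgn (form H v : R)).
Proof.
rewrite eq_sym; case: s => [[]|]; rewrite /half.
- by rewrite sgn_true.
- by rewrite sgn_false.
- by rewrite sgn_None mem_hyperplane.
Qed.

Lemma cellE s v : cell s v = (s == sign_vector v).
Proof.
apply/forallP/eqP => [h|-> H]; last by rewrite half_sgn ffunE.
by apply/ffunP => H; rewrite ffunE; apply/eqP; rewrite -half_sgn.
Qed.

Fact face_of_subproof v : `[< exists u, cell (sign_vector v) u >].
Proof. by apply/asboolP; exists v; rewrite cellE. Qed.
Definition face_of v : face A := Face (face_of_subproof v).

Lemma face_ofE v H : face_of v H = sgn (form H v : R).
Proof. by rewrite ffunE. Qed.

Lemma face_eqP x y : (forall H, x H = y H) -> x = y.
Proof. by move=> h; apply/val_inj/ffunP. Qed.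

Fact point_subproof x : exists v, cell x v.
Proof. by have /asboolP := face_nonempty x. Qed.
Definition point x : V := xchoose (point_subproof x).

Lemma pointE x H : x H = sgn (form H (point x) : R).
Proof.
by have := xchooseP (point_subproof x); rewrite cellE => /eqP {1}->; rewrite ffunE.
Qed.

Lemma face_of_point x : face_of (point x) = x.
Proof. by apply: face_eqP => H; rewrite face_ofE -pointE. Qed.

Lemma mulfaceE x y H : mulface x y H = if x H == None then y H else x H.
Proof. by rewrite ffunE. Qed.

Definition oppface x := face_of (- point x).

Lemma oppfaceE x H : oppface x H = omap negb (x H).
Proof. by rewrite face_ofE linearN /= sgnN -pointE. Qed.

Lemma mem_supp x v : reflect (forall H, x H = None -> form H v = 0 :> R) (v \in supp x).
Proof.
apply: (iffP idP) => [vx H xH|h].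
  apply/eqP; rewrite -mem_hyperplane; apply: (subvP _ _ vx).
  by apply: (bigcapv_inf H) => //; apply/eqP.
by rewrite memvE; apply/subv_bigcapP => H /eqP/h/eqP; rewrite -mem_hyperplane memvE.
Qed.

Lemma point_supp x : point x \in supp x.
Proof. by apply/mem_supp => H /eqP; rewrite pointE sgn_None => /eqP. Qed.

Lemma supp_sub_hyperplane x H : (supp x <= val H)%VS = (x H == None).
Proof.
apply/idP/idP => [/subvP/(_ _ (point_supp x))|xH].
  by rewrite mem_hyperplane pointE sgn_None.
exact: (bigcapv_inf H).
Qed.

Lemma sub_supp U x : reflect (forall H, x H = None -> (U <= val H)%VS) (U <= supp x)%VS.
Proof.
apply: (iffP subv_bigcapP) => h H; first by move/eqP/h.
by move/eqP/h.
Qed.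

Lemma supp_subP x y :
  reflect (forall H, y H = None -> x H = None) (supp x <= supp y)%VS.
Proof.
apply: (iffP (sub_supp _ _)) => h H /h; first by rewrite supp_sub_hyperplane => /eqP.
by move=> xH; rewrite supp_sub_hyperplane xH.
Qed.

Lemma supp_eqP x y : (forall H, (x H == None) = (y H == None)) <-> supp x = supp y.
Proof.
split=> [h|e H]; last by rewrite -!supp_sub_hyperplane e.
apply/eqP; rewrite eqEsubv; apply/andP; split; apply/supp_subP => H /eqP yH.
  by apply/eqP; rewrite h.
by apply/eqP; rewrite -h.
Qed.

Lemma mem_supp_face v x : (v \in supp x) = (supp (face_of v) <= supp x)%VS.
Proof.
apply/mem_supp/supp_subP => h H /h; rewrite face_ofE; last first.
  by move/eqP; rewrite sgn_None => /eqP.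
by move=> ->; rewrite /sgn ltxx.
Qed.

Lemma supp_le x y : sign_le x y -> (supp x <= supp y)%VS.
Proof.
move=> /sign_leP xy; apply/supp_subP => H yH; apply/eqP; apply: contraPT yH => xH.
by rewrite xy //; apply/eqP.
Qed.

Lemma supp_mull x y : (supp x <= supp y)%VS -> supp (mulface x y) = supp y.
Proof.
move=> /supp_subP xy; apply/supp_eqP => H; rewrite mulfaceE.
case: (eqVneq (y H) None) => [yH|yH]; first by rewrite (xy _ yH) yH.
by case: ifP => [_|]; rewrite ?(negbTE yH).
Qed.

Lemma le_mulface x y : sign_le x (mulface x y).
Proof. by apply/sign_leP => H xH; rewrite mulfaceE (negbTE xH). Qed.

(** A product of faces of points of [U], one outside each hyperplane that does not
    contain [U]: multiplication makes the points generic. *)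
Lemma exists_generic_face U :
  exists x, forall H, (x H == None) = (U <= val H)%VS.
Proof.
suff [x xU xs] : exists2 x : face A, forall H, (U <= val H)%VS -> x H = None &
    forall H, H \in enum {: hyperplanes A} -> ~~ (U <= val H)%VS -> x H != None.
  exists x => H; apply/idP/idP => [|/xU->//].
  by apply: contraTT; apply: xs; rewrite mem_enum.
elim: (enum _) => [|K s [x xU xs]].
  by exists (oneface A) => // H _; rewrite ffunE.
have [UK|/subvPn[u uU uK]] := boolP (U <= val K)%VS.
  exists x => // H; rewrite inE => /orP[/eqP->|/xs//]; by rewrite UK.
exists (mulface x (face_of u)) => H.
  move=> UH; rewrite mulfaceE xU //= face_ofE.
  by apply/eqP; rewrite sgn_None -mem_hyperplane; apply: (subvP UH).
rewrite inE mulfaceE => HKs UH; case: ifPn => // xH.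
move: HKs => /orP[/eqP->|Hs]; first by rewrite face_ofE sgn_None -mem_hyperplane.
by have := xs H Hs UH; rewrite xH.
Qed.

Definition flats : seq {vspace V} := codom (@supp R d A).

Lemma supp_flat x : supp x \in flats.
Proof. exact: codom_f. Qed.

Lemma flatP X : X \in flats -> exists x, supp x = X.
Proof. by case/codomP => x ->; exists x. Qed.

Lemma flat_cap X H : X \in flats -> (X :&: val H)%VS \in flats.
Proof.
case/flatP => y <-; have [x xE] := exists_generic_face (supp y :&: val H).
suff <- : supp x = (supp y :&: val H)%VS by apply: supp_flat.
apply/eqP; rewrite eqEsubv subv_cap supp_sub_hyperplane xE capvSr andbT.
apply/andP; split; last by apply/sub_supp => K /eqP; rewrite xE.
apply/supp_subP => K yK; apply/eqP; rewrite xE.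
by apply: subv_trans (capvSl _ _) _; rewrite supp_sub_hyperplane yK.
Qed.

Lemma flat_separate X Y : X \in flats -> ~~ (Y <= X)%VS ->
  exists2 H : hyperplanes A, (X <= val H)%VS & ~~ (Y <= val H)%VS.
Proof.
case/flatP => x <- /subvPn[v vY vx]; apply: contrapT => h; case/negP: vx.
apply/mem_supp => H xH; apply/eqP; rewrite -mem_hyperplane.
apply: contraT => vH; case: h; exists H; first by rewrite supp_sub_hyperplane xH.
by apply: contra vH => /subvP; apply.
Qed.

Definition covers X Y := (X <= Y)%VS && (\dim Y == (\dim X).+1).

Lemma covers_sub X Y : covers X Y -> (X <= Y)%VS. Proof. by case/andP. Qed.

Lemma covers_dim X Y : covers X Y -> \dim Y = (\dim X).+1.
Proof. by case/andP => _ /eqP. Qed.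

Lemma covers_nsub X Y : covers X Y -> ~~ (Y <= X)%VS.
Proof.
by case/andP=> _ /eqP e; apply/negP => /dimvS; rewrite e ltnn.
Qed.

Lemma cap_covers Y H : ~~ (Y <= val H)%VS -> covers (Y :&: val H) Y.
Proof.
move=> YH; rewrite /covers capvSl eqn_leq /=; apply/andP; split.
  rewrite -[X in (X <= _)%N](limg_ker_dim (form H) Y) form_kernel.
  rewrite -[X in (_ <= X)%N]addn1 leq_add2l.
  by rewrite (leq_trans (dimvS (subvf _))) // dimvf.
rewrite ltnNge (geq_leqif (dimv_leqif_sup (capvSl _ _))).
by rewrite subv_cap subvv.
Qed.

Lemma covers_cap X Y H : covers X Y -> (X <= val H)%VS -> ~~ (Y <= val H)%VS ->
  X = (Y :&: val H)%VS.
Proof.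
move=> cXY XH YH; apply/eqP.
rewrite -(geq_leqif (dimv_leqif_eq _)) ?subv_cap ?XH ?covers_sub //.
by rewrite -ltnS -(covers_dim cXY) (covers_dim (cap_covers YH)).
Qed.

(** Covering is expressed by dimensions, but depends only on the order of the
    flats, because the cut of a flat by a hyperplane is a flat. *)
Lemma covers_flatP X Y : X \in flats -> Y \in flats ->
  reflect ([/\ (X <= Y)%VS, X <> Y & forall Z, Z \in flats ->
             (X <= Z)%VS -> (Z <= Y)%VS -> Z = X \/ Z = Y])
          (covers X Y).
Proof.
move=> XF YF; apply: (iffP idP) => [cXY|[XY neXY h]].
  split; [exact: covers_sub | by move=> e; have := covers_nsub cXY; rewrite e subvv |].
  move=> Z _ XZ ZY; have := dimvS ZY; rewrite (covers_dim cXY) leq_eqVlt ltnS.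
  case/orP => dimZ; [right|left]; apply/eqP.
    by rewrite -(dimv_leqif_eq ZY) (covers_dim cXY).
  by rewrite eq_sym -(geq_leqif (dimv_leqif_eq XZ)).
have [|H XH YH] := @flat_separate X Y XF.
  by apply/negP => YX; apply: neXY; apply/eqP; rewrite eqEsubv XY.
have cYH := cap_covers YH.
have [||<-//|e] := h (Y :&: val H)%VS (flat_cap _ YF); rewrite ?capvSl ?subv_cap ?XY //.
by case/negP: YH; rewrite -e capvSr.
Qed.

Lemma eliminate u v H : face_of u H != None -> face_of v H != None ->
  face_of u H != face_of v H ->
  exists s t, [/\ 0 < s, 0 < t & face_of (s *: u + t *: v) H = None].
Proof.
rewrite !face_ofE => uH vH ne; have [s [t [s0 t0 e]]] := sgn_eliminate uH vH ne.
exists s, t; split=> //; rewrite face_ofE linearD !linearZ /= /GRing.scale /= e.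
by rewrite /sgn ltxx.
Qed.

Lemma face_of_comb s t u v H : 0 < s -> 0 < t -> face_of u H = face_of v H ->
  face_of (s *: u + t *: v) H = face_of u H.
Proof.
rewrite !face_ofE => s0 t0 e; rewrite linearD !linearZ /= /GRing.scale /=.
exact: sgn_comb.
Qed.

Lemma face_of_combl s t u v H : 0 < s -> face_of v H = None ->
  face_of (s *: u + t *: v) H = face_of u H.
Proof.
rewrite !face_ofE => s0 /eqP; rewrite sgn_None => /eqP e.
by rewrite linearD !linearZ /= /GRing.scale /= e mulr0 addr0 sgn_pmul.
Qed.

Lemma face_of_combr s t u v H : 0 < t -> face_of u H = None ->
  face_of (s *: u + t *: v) H = face_of v H.
Proof. by rewrite addrC; apply: face_of_combl. Qed.

Section Sides.
Variables (Z Y : {vspace V}) (H : hyperplanes A).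
Hypotheses (ZF : Z \in flats) (YF : Y \in flats).
Hypotheses (cZY : covers Z Y) (ZH : (Z <= val H)%VS) (YH : ~~ (Y <= val H)%VS).

(** If [y] and [y'] differ, they are separated by some [K], with [Y :&: val K = Z].
    A segment from [y] to [y'] meets [Z] there, while it stays on one side of [H]. *)
Lemma side_unique z y y' : supp z = Z -> supp y = Y -> supp y' = Y ->
  sign_le z y -> sign_le z y' -> y H = y' H -> y = y'.
Proof.
move=> sz sy sy' /sign_leP zy /sign_leP zy' yy'H.
apply: face_eqP => K; apply/eqP; apply: contraT => neK.
have eqN := (supp_eqP y y').2 (etrans sy (esym sy')).
have yK : y K != None.
  by apply: contraNneq neK => yK; move: (eqN K); rewrite yK eqxx eq_sym.
have y'K : y' K != None by rewrite -eqN.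
have ZK : (Z <= val K)%VS.
  rewrite -sz supp_sub_hyperplane; apply: contraNT neK => zK.
  by rewrite zy // zy'.
have YK : ~~ (Y <= val K)%VS by rewrite -sy supp_sub_hyperplane.
have [||| s [t [s0 t0 qK]]] := @eliminate (point y) (point y') K;
  rewrite ?face_of_point //.
set q := face_of _ in qK.
have qY : (supp q <= Y)%VS.
  rewrite -sy; apply/supp_subP => G yG; rewrite /q face_of_combl ?face_of_point //.
  by apply/eqP; rewrite -eqN yG.
have : (supp q <= Z)%VS.
  by rewrite (covers_cap cZY ZK YK) subv_cap qY supp_sub_hyperplane qK.
move/subv_trans/(_ ZH); rewrite supp_sub_hyperplane face_of_comb ?face_of_point //.
by move: YH; rewrite -sy supp_sub_hyperplane => /negbTE->.
Qed.

(** Start at [z] and move towards a face of [Y] or towards its opposite. *)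
Lemma side_exists z b : supp z = Z ->
  exists y, [/\ supp y = Y, sign_le z y & y H = Some b].
Proof.
move=> sz; have [y sy] := flatP YF.
have [b' yH] : exists b', y H = Some b'.
  by move: YH; rewrite -sy supp_sub_hyperplane; case: (y H) => // b' _; exists b'.
pose y' := if b == b' then y else oppface y.
have sy' : supp y' = Y.
  rewrite /y'; case: eqP => // _; rewrite -sy; apply/supp_eqP => K.
  by rewrite oppfaceE; case: (y K).
exists (mulface z y'); split.
- by rewrite supp_mull ?sy' // sz covers_sub.
- exact: le_mulface.
- rewrite mulfaceE -supp_sub_hyperplane sz ZH /y'; case: eqP => [->//|/eqP].
  by rewrite oppfaceE yH; case: (b) (b') => [] [].
Qed.

End Sides.

End Faces.

(** * Incidence numbers and the square of the coboundary *)

Section Incidence.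
Context {R : realType} {d : nat} (A : arrangement R d) (k : fieldType).
Local Notation V := 'rV[R]_d.
Local Notation flats := (flats A).
Local Notation orient := (orient flats).
Local Notation wedge := (wedge flats).
Implicit Types (H K : hyperplanes A) (u v w : V) (x y z : face A).
Implicit Types (U W X Y Z : {vspace V}).

(** On [Y], both forms have kernel [Z]. *)
Lemma orient_proportional Z Y H u v : Z \in flats -> Y \in flats -> covers Z Y ->
  (Z <= val H)%VS -> ~~ (Y <= val H)%VS -> u \in Y -> v \in Y ->
  (orient Z Y u : R) * form H v = orient Z Y v * form H u.
Proof.
move=> ZF YF cZY ZH YH uY vY; have ZY := covers_sub cZY.
pose e : V := (form H v : R) *: u - (form H u : R) *: v.
have eZ : e \in Z.
  rewrite (covers_cap cZY ZH YH) memv_cap memvB ?memvZ //= mem_hyperplane.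
  rewrite /e (linearB (form H)) !(linearZZ (form H)) /=.
  by rewrite /GRing.scale /= mulrC subrr.
have := orient0 ZF ZY eZ; rewrite /e (linearB (orient Z Y)) !(linearZZ (orient Z Y)).
by rewrite /GRing.scale /= => /subr0_eq; rewrite mulrC [in RHS]mulrC.
Qed.

Lemma orient_neq0 Z Y v : Z \in flats -> Y \in flats -> covers Z Y ->
  v \in Y -> v \notin Z -> (orient Z Y v : R) != 0.
Proof.
move=> ZF YF cZY vY; apply: contra => /eqP; apply: orient_eq0 => //.
  exact: covers_sub.
by rewrite (covers_dim cZY).
Qed.

(** The sign tells on which side of [supp z] the face [y] lies. *)
Definition incidence z y : k :=
  if sign_le z y && covers (supp z) (supp y)
  then (sgz (orient (supp z) (supp y) (point y) : R))%:~R else 0.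

Lemma incidence_neq0 z y : incidence z y != 0 ->
  sign_le z y /\ covers (supp z) (supp y).
Proof. by rewrite /incidence; case: ifP => [/andP[]//|]; rewrite eqxx. Qed.

Section Facet.
Variables (Z Y : {vspace V}) (H : hyperplanes A).
Hypotheses (ZF : Z \in flats) (YF : Y \in flats).
Hypotheses (cZY : covers Z Y) (ZH : (Z <= val H)%VS) (YH : ~~ (Y <= val H)%VS).

Lemma facet_sign y : supp y = Y -> exists b, y H = Some b.
Proof.
move=> sy; move: YH; rewrite -sy supp_sub_hyperplane.
by case: (y H) => // b _; exists b.
Qed.

(** The sign [e] depends on the flats and on [H], not on the faces. *)
Lemma incidence_side : exists2 e : k, e * e = 1 &
  forall z y, supp z = Z -> supp y = Y -> sign_le z y ->
    incidence z y = if y H == Some true then e else - e.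
Proof.
have [z sz] := flatP ZF; have [y [sy zy yH]] := side_exists YF cZY ZH YH true sz.
pose o v : R := orient Z Y v; pose v := point y.
have vY : v \in Y by rewrite -sy point_supp.
have hv : 0 < (form H v : R) by rewrite -sgn_true -pointE yH.
have ov : o v != 0.
  apply: orient_neq0 => //; apply/negP => /(subvP ZH).
  by rewrite mem_hyperplane gt_eqF.
exists (sgz (o v))%:~R.
  by rewrite -intrM mulz_sg ov mulr1z.
move=> z' y' sz' sy' zy'; rewrite /incidence sz' sy' zy' cZY /=.
have pY : point y' \in Y by rewrite -sy' point_supp.
have := orient_proportional ZF YF cZY ZH YH pY vY.
move/(congr1 (@sgz R)); rewrite !sgzM (gtr0_sgz hv) mulr1 => ->.
have [b y'H] := facet_sign sy'; rewrite y'H.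
move/eqP: y'H; rewrite pointE; case: b.
  by rewrite sgn_true => /gtr0_sgz ->; rewrite mulr1.
by rewrite sgn_false => /ltr0_sgz ->; rewrite mulrN1 intrN.
Qed.

Lemma incidence_side_sum : exists2 e : k, e * e = 1 & forall z, supp z = Z ->
  exists yp ym, [/\ supp yp = Y, supp ym = Y, sign_le z yp, sign_le z ym &
    [/\ yp H = Some true, ym H = Some false &
    forall (T : lmodType k) (G : face A -> T),
      \sum_(y | supp y == Y) incidence z y *: G y = e *: (G yp - G ym)]].
Proof.
have [e ee eP] := incidence_side; exists e => // z sz.
have [yp [syp zyp ypH]] := side_exists YF cZY ZH YH true sz.
have [ym [sym zym ymH]] := side_exists YF cZY ZH YH false sz.
exists yp, ym; split=> //; split=> // T G.
have neq : ym != yp by apply: contra_eq_neq ypH => <-; rewrite ymH.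
rewrite (bigD1 yp) ?syp //= (bigD1 ym) ?sym ?eqxx //= big1 => [|y].
  by rewrite !eP // ypH ymH eqxx /= addr0 scaleNr scalerBr.
case/andP=> /andP[/eqP sy ney neym]; rewrite /incidence.
case: ifP => [/andP[zy _]|]; last by rewrite scale0r.
have [[] yH] := facet_sign sy.
  by case/eqP: ney; apply: (side_unique cZY ZH YH sz sy syp zy zyp); rewrite yH.
by case/eqP: neym; apply: (side_unique cZY ZH YH sz sy sym zy zym); rewrite yH.
Qed.

End Facet.

Lemma covers_separate Z Y : Z \in flats -> covers Z Y ->
  exists2 H : hyperplanes A, (Z <= val H)%VS & ~~ (Y <= val H)%VS.
Proof. by move=> ZF /covers_nsub; apply: flat_separate. Qed.

(** The faces between [w] and [y], of codimension two over [w], are the two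
    sides of the sector that [y] cuts out of the plane [Y / W]. *)
Section Square.
Variables (w y : face A).
Let W := supp w.
Let Y := supp y.
Let p := point y.
Hypotheses (wy : sign_le w y) (dimWY : \dim Y = (\dim W).+2).
Let WF : W \in flats := supp_flat w.
Let YF : Y \in flats := supp_flat y.
Let WY : (W <= Y)%VS := supp_le wy.
Let pY : p \in Y := point_supp y.

Definition between z :=
  [&& sign_le w z, sign_le z y, covers W (supp z) & covers (supp z) Y].

Lemma between_wedge z v : between z -> v \in supp z ->
  (orient W (supp z) v : R) * orient (supp z) Y p = wedge W Y v p.
Proof.
case/and4P => wz zy cWz czY vz; apply: orientM => //.
- exact: supp_flat.
- exact: covers_sub.
- exact: covers_sub.
- exact: covers_dim.
Qed.

Lemma between_incidence z : between z ->
  incidence w z * incidence z y = (sgz (wedge W Y (point z) p))%:~R.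
Proof.
move=> bz; rewrite -(between_wedge bz (point_supp z)) sgzM intrM.
by case/and4P: bz => wz zy cWz czY; rewrite /incidence wz zy cWz czY.
Qed.

Lemma between_wedge_neq0 z : between z -> wedge W Y (point z) p != 0.
Proof.
move=> bz; rewrite -(between_wedge bz (point_supp z)).
case/and4P: bz => wz zy cWz czY; rewrite mulf_neq0 //.
  apply: orient_neq0; rewrite ?supp_flat ?point_supp //.
  by apply: contra (covers_nsub cWz); rewrite mem_supp_face face_of_point.
apply: orient_neq0; rewrite ?supp_flat //.
by apply: contra (covers_nsub czY); rewrite mem_supp_face face_of_point.
Qed.

(* The sign of [c] selects one of the two sides of [p] in the plane. *)
Variable c : R.
Let beta u v : R := c * wedge W Y u v.

(** Otherwise [z2] would be strictly between [z1] and [y] in the plane; but it lies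
    on a hyperplane that has [y] on one side, and [z1] not on the other. *)
Lemma between_noncrossing z1 z2 : between z1 -> between z2 ->
  0 < beta (point z1) p -> 0 < beta (point z2) p ->
  beta (point z1) (point z2) <= 0.
Proof.
move=> b1 b2 c1 c2; rewrite leNgt; apply/negP => c12.
case/and4P: (b1) => wz1 z1y cWz1 cz1Y; case/and4P: (b2) => wz2 z2y cWz2 cz2Y.
have [K z2K yK] := covers_separate (supp_flat z2) cz2Y.
have v1Y : point z1 \in Y by apply: (subvP (supp_le z1y)); apply: point_supp.
have v2Y : point z2 \in Y by apply: (subvP (supp_le z2y)); apply: point_supp.
have := wedge_cramer WF YF WY (eq_leq dimWY) v1Y v2Y pY.
set e := _ - _ => /(subvP (subv_trans (supp_le wz2) z2K)).
rewrite mem_hyperplane /e (linearB (form K)) (linearD (form K)) !(linearZZ (form K)).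
rewrite /GRing.scale /=.
have /eqP -> : (form K (point z2) == 0 :> R).
  by rewrite -sgn_None -pointE -supp_sub_hyperplane.
move/eqP/(congr1 ( *%R (- c))); rewrite mulr0 sub0r mulr0 mulrNN.
rewrite mulrDr !mulrA -/(beta _ _) -/(beta _ _).
have hp : sgn (form K p : R) != None by rewrite -pointE -supp_sub_hyperplane.
have [h1|h1] := eqVneq (sgn (form K (point z1) : R)) None.
  move: h1 => /eqP; rewrite sgn_None => /eqP ->; rewrite mulr0 add0r => /eqP.
  by rewrite mulf_eq0 gt_eqF //= -sgn_None (negbTE hp).
move/(congr1 (@sgn R)); rewrite sgn_comb //.
  by move=> h; case/negP: h1; rewrite h sgn_None.
rewrite -!pointE; move/sign_leP: z1y => -> //.
by rewrite pointE.
Qed.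

(** The determinant of [z1] and [z2] vanishes, so they are positive multiples of
    each other modulo [W]. *)
Lemma between_unique z1 z2 : between z1 -> between z2 ->
  0 < beta (point z1) p -> 0 < beta (point z2) p -> z1 = z2.
Proof.
move=> b1 b2 c1 c2.
have := between_noncrossing b1 b2 c1 c2.
have := between_noncrossing b2 b1 c2 c1.
rewrite {1}/beta wedgeC mulrN oppr_le0 -/(beta _ _) => g0 l0.
have {g0 l0} e0 : beta (point z1) (point z2) = 0 by apply/eqP; rewrite eq_le l0.
case/and4P: (b1) => wz1 z1y cWz1 cz1Y; case/and4P: (b2) => wz2 z2y cWz2 cz2Y.
have v1Y : point z1 \in Y by apply: (subvP (supp_le z1y)); apply: point_supp.
have v2Y : point z2 \in Y by apply: (subvP (supp_le z2y)); apply: point_supp.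
have c0 : c != 0 by apply: contraTneq c1 => c0; rewrite /beta c0 mul0r ltxx.
move/eqP: e0; rewrite mulf_eq0 (negbTE c0) /= => /eqP e0.
have := wedge_cramer WF YF WY (eq_leq dimWY) v1Y v2Y pY; rewrite e0 scale0r addr0.
set e := _ - _ => eW; apply: face_eqP => K.
have [WK|WK] := boolP (W <= val K)%VS; last first.
  move: WK; rewrite supp_sub_hyperplane => wK.
  by move/sign_leP: wz1 => ->//; move/sign_leP: wz2 => ->.
have := subvP WK _ eW.
rewrite mem_hyperplane /e (linearB (form K)) !(linearZZ (form K)).
rewrite /GRing.scale /= => /eqP/(congr1 ( *%R c)); rewrite mulr0 mulrBr => /subr0_eq.
rewrite !mulrA -/(beta _ _) -/(beta _ _) => /(congr1 (@sgn R)).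
by rewrite !sgn_pmul // -!pointE.
Qed.

(** Turn [v] towards [p] until no hyperplane separates its face from [y]: each step
    stops on a separating hyperplane, which then ceases to separate. *)
Lemma between_exists v : sign_le w (face_of A v) -> v \in Y ->
  (exists2 K : hyperplanes A, form K v = 0 :> R & ~~ (Y <= val K)%VS) ->
  0 < beta v p -> exists2 u, between (face_of A u) & 0 < beta u p.
Proof.
pose S u := [set H : hyperplanes A | (face_of A u H != None) && (face_of A u H != y H)].
have [n] := ubnP #|S v|; elim: n v => // n ih v.
rewrite ltnS => leSn wv vY [K vK YK] pos.
have vYs : (supp (face_of A v) <= Y)%VS by rewrite -mem_supp_face.
have [S0|[H HS]] := set_0Vmem (S v).
  exists v => //; have vy : sign_le (face_of A v) y.
    apply/sign_leP => H vH; apply/eqP; apply: contraT => ne.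
    suff : H \in S v by rewrite S0 inE.
    by rewrite inE vH eq_sym.
  rewrite /between wv vy /covers supp_le //= vYs /=.
  have vW : v \notin W.
    apply/negP => vW; move: pos; rewrite /beta (wedge0 WF WY p vW).
    by rewrite mulr0 ltxx.
  have lt1 : (\dim W < \dim (supp (face_of A v)))%N.
    rewrite ltnNge; apply/negP; rewrite (geq_leqif (dimv_leqif_sup (supp_le wv))).
    by rewrite -mem_supp_face; apply/negP.
  have lt2 : (\dim (supp (face_of A v)) < \dim Y)%N.
    rewrite ltnNge; apply/negP; rewrite (geq_leqif (dimv_leqif_sup vYs)) => YZ.
    case/negP: YK; apply: subv_trans YZ _.
    by rewrite supp_sub_hyperplane face_ofE vK /sgn ltxx.
  move: lt2; rewrite dimWY ltnS => le2.
  have -> : \dim (supp (face_of A v)) = (\dim W).+1.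
    by apply/eqP; rewrite eqn_leq lt1 le2.
  by rewrite !eqxx.
move: (HS); rewrite inE => /andP[vH neH].
have yH : y H != None.
  apply: contra vH; rewrite -!supp_sub_hyperplane; exact: subv_trans.
have := @eliminate R d A v p H vH; rewrite face_of_point => /(_ yH neH).
case=> s [t [s0 t0 qH]]; apply: (ih (s *: v + t *: p)).
- apply: leq_trans leSn; apply: proper_card; apply/properP; split.
    apply/subsetP => G; rewrite !inE => /andP[qG].
    have [vG|vG] := eqVneq (face_of A v G) None.
      by rewrite face_of_combr // face_of_point eqxx.
    move=> /= ne; apply: contraNN ne => /eqP vy.
    by rewrite face_of_comb ?face_of_point // vy.
  by exists H => //; rewrite inE qH.
- apply/sign_leP => G wG; move/sign_leP: wv => /(_ G wG) vG.
  rewrite face_of_comb // vG; move/sign_leP: wy => /(_ G wG).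
  by rewrite /p face_of_point.
- by rewrite memvD ?memvZ.
- exists H; last by rewrite supp_sub_hyperplane.
  by apply/eqP; rewrite -sgn_None -face_ofE qH.
- rewrite /beta wedgeDl !wedgeZl.
  have -> : wedge W Y p p = 0 by rewrite /wedge mulrC subrr.
  by rewrite mulr0 addr0 mulrCA mulr_gt0.
Qed.

Lemma wedge_side Z u v H : Z \in flats -> covers W Z -> covers Z Y ->
  (W <= val H)%VS -> ~~ (Z <= val H)%VS -> u \in Z -> v \in Z ->
  0 < beta v p * (form H u * form H v) -> 0 < beta u p.
Proof.
move=> ZF cWZ cZY WH ZH uZ vZ pos.
have oM (t : V) : t \in Z -> wedge W Y t p = (orient W Z t : R) * orient Z Y p.
  by move=> tZ; rewrite (@orientM _ _ _ W Z Y) ?covers_sub // (covers_dim cWZ).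
have op := orient_proportional WF ZF cWZ WH ZH uZ vZ.
have hv : (form H v : R) != 0.
  by apply: contraTneq pos => ->; rewrite !mulr0 ltxx.
have hv2 : 0 < (form H v : R) * form H v by rewrite -expr2 exprn_even_gt0.
rewrite -(pmulr_lgt0 _ hv2); apply: etrans pos; congr (0 < _).
rewrite /beta !oM //.
rewrite [LHS](_ : _ =
  c * orient Z Y p * ((orient W Z u : R) * form H v) * form H v); last by ring.
by rewrite op; ring.
Qed.

(** If [z0] is on the wrong side of [p], then start with its reflection in [w]. *)
Lemma between_sign z0 : between z0 -> c != 0 ->
  exists2 z, between z & 0 < beta (point z) p.
Proof.
move=> b0 c0; case/and4P: (b0) => wz0 z0y cWZ cZY.
have [H WH ZH] := covers_separate WF cWZ.
have [K ZK YK] := covers_separate (supp_flat z0) cZY.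
suff [v [wv vZ pos]] :
    exists v, [/\ sign_le w (face_of A v), v \in supp z0 & 0 < beta v p].
  have vY : v \in Y by apply: (subvP (covers_sub cZY)).
  have [|u bu upos] := between_exists wv vY _ pos.
    exists K => //; apply/eqP; rewrite -mem_hyperplane; exact: (subvP ZK).
  exists (face_of A u) => //; case/and4P: bu => wu uy cWu cuY.
  have [G WG uG] := covers_separate WF cWu.
  apply: (wedge_side (supp_flat (face_of A u)) cWu cuY WG uG (point_supp _) (v := u)).
    by rewrite mem_supp_face.
  rewrite mulr_gt0 //.
  by apply: sgn_mul_gt0; rewrite -pointE ?face_ofE // -face_ofE -supp_sub_hyperplane.
have := between_wedge_neq0 b0; rewrite -(mulrI_eq0 _ (mulfI c0)) -/(beta _ _).
rewrite neq_lt => /orP[neg|pos]; last first.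
  by exists (point z0); rewrite face_of_point point_supp.
have [b z0H] : exists b, z0 H = Some b.
  by move: ZH; rewrite supp_sub_hyperplane; case: (z0 H) => // b _; exists b.
have [z [sz wz zH]] := side_exists (supp_flat z0) cWZ WH ZH (~~ b) (erefl W).
exists (point z); rewrite face_of_point -sz point_supp; split=> //.
apply: (wedge_side (supp_flat z0) cWZ cZY WH ZH (u := point z) (v := point z0)).
- by rewrite -sz point_supp.
- exact: point_supp.
rewrite nmulr_rgt0 //.
move/eqP: zH; move/eqP: z0H; rewrite !pointE; case: b => /=.
  by rewrite sgn_true sgn_false => ? ?; rewrite nmulr_rlt0.
by rewrite sgn_true sgn_false => ? ?; rewrite pmulr_rlt0.
Qed.

End Square.

(** Exactly one face between [w] and [y] contributes [1], and exactly one [-1]. *)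
Lemma incidence_square (w y : face A) : \sum_z incidence w z * incidence z y = 0.
Proof.
have [z0 nz0|all0] := pickP (fun z => incidence w z * incidence z y != 0); last first.
  by apply: big1 => z _; apply/eqP/negbFE/all0.
have btw z : incidence w z * incidence z y != 0 -> between w y z.
  rewrite mulf_eq0 negb_or => /andP[/incidence_neq0[wz cwz] /incidence_neq0[zy czy]].
  exact/and4P.
have b0 := btw _ nz0; case/and4P: (b0) => wz0 z0y cWZ cZY.
have wy := sign_le_trans wz0 z0y.
have dimY : \dim (supp y) = (\dim (supp w)).+2.
  by rewrite (covers_dim cZY) (covers_dim cWZ).
pose b z := wedge (supp w) (supp y) (point z) (point y).
have [zp bp zp0] := between_sign wy dimY b0 (oner_neq0 R).
have [zm bm zm0] : exists2 z, between w y z & 0 < -1 * b z.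
  by apply: between_sign b0 _; rewrite // oppr_eq0 oner_neq0.
have up z : between w y z -> 0 < b z -> z = zp.
  by move=> bz z0'; apply: (between_unique wy dimY bz bp (c := 1)); rewrite // mul1r.
have um z : between w y z -> b z < 0 -> z = zm.
  move=> bz z0'; apply: (between_unique wy dimY bz bm (c := -1)) => //.
  by rewrite mulN1r oppr_gt0.
move: zp0 zm0; rewrite mul1r mulN1r oppr_gt0 -/(b zp) => zp0 zm0.
have ne : zm != zp by apply: contraTneq zp0 => <-; rewrite -leNgt ltW.
rewrite (bigD1 zp) //= (bigD1 zm) //= big1 => [|z /andP[nep nem]].
  rewrite !between_incidence // -/(b zp) -/(b zm).
  by rewrite gtr0_sgz // ltr0_sgz // addr0 subrr.
apply/eqP; apply: contraT => /btw bz.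
have := between_wedge_neq0 bz; rewrite -/(b z) neq_lt => /orP[/um|/up] e.
  by case/eqP: nem; apply: e.
by case/eqP: nep; apply: e.
Qed.

End Incidence.

(** * Connectedness and exactness in convex regions *)

Section Exactness.
Context {R : realType} {d : nat} (A : arrangement R d) (k : fieldType).
Local Notation V := 'rV[R]_d.
Local Notation flats := (flats A).
Local Notation incidence := (incidence k).
Implicit Types (H K : hyperplanes A) (v w x y z : face A) (c : face A -> k).
Implicit Types (X Y Z : {vspace V}) (t : {ffun hyperplanes A -> sign}).

Definition coboundary c y : k := \sum_z c z * incidence z y.

Lemma coboundaryP a c c' y :
  coboundary (fun z => a * c z + c' z) y = a * coboundary c y + coboundary c' y.
Proof.
rewrite /coboundary mulr_sumr -big_split; apply: eq_bigr => z _ /=; ring.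
Qed.

Lemma coboundaryD c c' y :
  coboundary (fun z => c z + c' z) y = coboundary c y + coboundary c' y.
Proof. by rewrite /coboundary -big_split; apply: eq_bigr => z _; rewrite mulrDl. Qed.

Lemma coboundary2 c y : coboundary (coboundary c) y = 0.
Proof.
rewrite /coboundary; under eq_bigr => z _ do rewrite mulr_suml.
rewrite exchange_big big1 // => w _; under eq_bigr => z _ do rewrite -mulrA.
by rewrite -mulr_sumr incidence_square mulr0.
Qed.

(** The two faces of [Y] next to [z] cancel. *)
Lemma incidence_sum0 z Y : Y \in flats -> \sum_(y | supp y == Y) incidence z y = 0.
Proof.
move=> YF; have [cZY|ncZY] := boolP (covers (supp z) Y); last first.
  apply: big1 => y /eqP sy; rewrite /incidence sy (negbTE ncZY) andbF //.
have [H ZH YH] := covers_separate (supp_flat z) cZY.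
have [e _ /(_ z erefl)[yp [ym [_ _ _ _ [_ _ sumE]]]]] :=
  incidence_side_sum k (supp_flat z) YF cZY ZH YH.
have := sumE k^o (fun=> 1); rewrite subrr scaler0 => {2}<-.
by apply: eq_bigr => y _; rewrite /GRing.scale /= mulr1.
Qed.

(** A partial sign vector [t] stands for the region of the faces [z] with
    [sign_le t z]. *)
Definition supported t c := forall z, ~~ sign_le t z -> c z = 0.

Lemma supported_coboundary t c : supported t c -> supported t (coboundary c).
Proof.
move=> tc y ty; apply: big1 => z _.
have [->|/incidence_neq0[zy _]] := eqVneq (incidence z y) 0; first exact: mulr0.
rewrite tc ?mul0r //; apply: contra ty => tz; exact: sign_le_trans zy.
Qed.

Definition extend t H b : {ffun hyperplanes A -> sign} :=
  [ffun K => if K == H then Some b else t K].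

Lemma le_extend t H b : t H = None -> sign_le t (extend t H b).
Proof.
move=> tH; apply/sign_leP => K; rewrite ffunE.
by case: (eqVneq K H) => [->|//]; rewrite tH eqxx.
Qed.

Lemma extend_le t H b z : sign_le t z -> z H = Some b -> sign_le (extend t H b) z.
Proof.
move=> /sign_leP tz zH; apply/sign_leP => K; rewrite ffunE.
by case: (eqVneq K H) => [->|_ /tz].
Qed.

Definition free_signs t := #|[set K | t K == None]|.

Lemma free_signs_extend t H b :
  t H = None -> (free_signs (extend t H b) < free_signs t)%N.
Proof.
move=> tH; apply: proper_card; apply/properP; split.
  apply/subsetP => K; rewrite !inE ffunE; by case: ifP.
by exists H; rewrite !inE ?ffunE ?eqxx ?tH.
Qed.

Lemma supported_extend t H b c :
  t H = None -> supported (extend t H b) c -> supported t c.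
Proof.
move=> tH tc z tz; apply: tc; apply: contra tz; apply: sign_le_trans.
exact: le_extend.
Qed.

(** Induction on the number of free signs.  If [H] separates [x] from [x'], there
    is a face [z] of [X :&: val H] in the region, generic on a segment from [x] to
    [x']; its two sides are joined to [x] and to [x'] without crossing [H]. *)
Lemma connected X t x x' : X \in flats -> supp x = X -> supp x' = X ->
  sign_le t x -> sign_le t x' ->
  exists2 c, supported t c &
    forall y, supp y = X -> coboundary c y = (y == x)%:R - (y == x')%:R.
Proof.
move=> XF; have [n] := ubnP (free_signs t).
elim: n t x x' => // n ih t x x'; rewrite ltnS => le sx sx' tx tx'.
have [->|nexx'] := eqVneq x x'.
  exists (fun=> 0) => // y _; rewrite subrr; apply: big1 => z _; exact: mul0r.
have [H neH] : exists H, x H != x' H.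
  apply: contrapT => h; case/eqP: nexx'; apply: face_eqP => H; apply/eqP.
  by apply: contraT => ne; case: h; exists H.
have eqN := (supp_eqP x x').2 (etrans sx (esym sx')).
have xH : x H != None.
  by apply: contraNneq neH => e; move: (eqN H); rewrite e eqxx eq_sym.
have x'H : x' H != None by rewrite -eqN.
have XH : ~~ (X <= val H)%VS by rewrite -sx supp_sub_hyperplane.
have tH : t H = None.
  apply/eqP; apply: contraNT neH => tH.
  by move/sign_leP: tx => ->//; move/sign_leP: tx' => ->.
have [||| s [r [s0 r0 qH]]] := @eliminate R d A (point x) (point x') H;
  rewrite ?face_of_point //.
set q := face_of _ _ in qH.
have qE K : x K = x' K -> q K = x K.
  by move=> e; rewrite /q face_of_comb ?face_of_point.
have qXH : (supp q <= X :&: val H)%VS.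
  rewrite subv_cap supp_sub_hyperplane qH andbT -sx; apply/supp_subP => K xK.
  by rewrite qE //; apply/eqP; rewrite xK eq_sym -eqN xK.
have [u su] := flatP (flat_cap H XF).
pose z := mulface q u; have sz : supp z = (X :&: val H)%VS by rewrite supp_mull ?su.
have tz : sign_le t z.
  apply: (sign_le_trans (y := q)); last exact: le_mulface.
  apply/sign_leP => K tK; have := tK.
  move/sign_leP: tx => /(_ K tK) xK; move/sign_leP: tx' => /(_ K tK) x'K _.
  by rewrite qE ?xK ?x'K.
have cXH := cap_covers XH; have ZF := flat_cap H XF.
have [e ee /(_ z sz)[yp [ym [syp sym zyp zym [ypH ymH sumE]]]]] :=
  incidence_side_sum k ZF XF cXH (capvSr _ _) XH.
have [b xb] : exists b, x H = Some b by case: (x H) xH => // b _; exists b.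
have xb' : x' H = Some (~~ b).
  by move: neH x'H; rewrite xb; case: (x' H) => [[]|]; case: (b).
have [e' [y1 [y2 [e1 [sy1 sy2] [zy1 zy2] [y1H y2H] dz]]]] :
    exists e' y1 y2, [/\ e' * e' = 1, supp y1 = X /\ supp y2 = X,
      sign_le z y1 /\ sign_le z y2, y1 H = Some b /\ y2 H = Some (~~ b) &
      forall y, supp y = X -> incidence z y = e' * ((y == y1)%:R - (y == y2)%:R)].
  have dz y : supp y = X -> incidence z y = e * ((y == yp)%:R - (y == ym)%:R).
    move=> sy; have := sumE k^o (fun y' => (y == y')%:R).
    rewrite (bigD1 y) ?sy //= eqxx big1 => [|y' /andP[_ /negbTE ne]].
      by rewrite addr0 /GRing.scale /= mulr1.
    by rewrite eq_sym ne scaler0.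
  case: b xb xb' => _ _; first by exists e, yp, ym.
  exists (- e), ym, yp; rewrite mulrNN; split=> // y /dz ->.
  by rewrite mulNr -mulrN opprB.
have lt b' := leq_trans (free_signs_extend b' tH) le.
have [|||||c1 c1t c1E] := ih (extend t H b) x y1; rewrite ?lt ?extend_le //.
  exact: sign_le_trans zy1.
have [|||||c2 c2t c2E] := ih (extend t H (~~ b)) y2 x'; rewrite ?lt ?extend_le //.
  exact: sign_le_trans zy2.
exists (fun v => e' * (v == z)%:R + (c1 v + c2 v)) => [v tv|y sy].
  rewrite (supported_extend tH c1t tv) (supported_extend tH c2t tv).
  case: eqP => [vz|_]; last by rewrite mulr0 !addr0.
  by move: tv; rewrite vz tz.
rewrite coboundaryP coboundaryD c1E // c2E //.
rewrite {1}/coboundary (bigD1 z) //= eqxx big1 => [|v /negbTE->]; last exact: mul0r.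
by rewrite mul1r addr0 dz // mulrA e1 mul1r; ring.
Qed.

(** A chain of total mass zero is a combination of differences of two faces. *)
Lemma connected_sum X t c : X \in flats -> supported t c ->
  \sum_(x | supp x == X) c x = 0 ->
  exists2 w, supported t w & forall x, supp x = X -> c x = coboundary w x.
Proof.
move=> XF tc sum0.
have [x0 /andP[/eqP sx0 nz0]|all0] :=
    pickP (fun x => (supp x == X) && (c x != 0)); last first.
  exists (fun=> 0) => // x sx; rewrite [RHS]big1 => [|z _]; last exact: mul0r.
  by have := all0 x; rewrite sx eqxx => /negbFE/eqP.
have ct x : c x != 0 -> sign_le t x by apply: contraNT => /tc ->.
have h x : exists w : face A -> k, supported t w /\ (supp x = X -> c x != 0 ->
    forall y, supp y = X -> coboundary w y = (y == x)%:R - (y == x0)%:R).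
  have [/andP[/eqP sx nz]|n] := boolP ((supp x == X) && (c x != 0)).
    by have [w tw wE] := connected XF sx sx0 (ct _ nz) (ct _ nz0); exists w.
  by exists (fun=> 0); split=> // sx nz; case/negP: n; rewrite sx eqxx.
have [w wP] := choice h.
exists (fun v => \sum_(x | supp x == X) c x * w x v) => [v tv|y sy].
  by apply: big1 => x _; rewrite (wP x).1 // mulr0.
rewrite /coboundary; under eq_bigr => z _ do rewrite mulr_suml.
rewrite exchange_big /=.
transitivity (\sum_(x | supp x == X) c x * ((y == x)%:R - (y == x0)%:R)).
  under eq_bigr => x _ do rewrite mulrBr.
  rewrite sumrB -[X in _ - X]mulr_suml sum0 mul0r subr0.
  rewrite (bigD1 y) ?sy //= eqxx mulr1 big1 ?addr0 // => x /andP[_].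
  by rewrite eq_sym => /negbTE ->; rewrite mulr0.
apply: eq_bigr => x /eqP sx; under [RHS]eq_bigr => z _ do rewrite -mulrA.
rewrite -mulr_sumr -/(coboundary (w x) y).
have [->|nz] := eqVneq (c x) 0; first by rewrite !mul0r.
by rewrite (wP x).2.
Qed.

(** The faces [z] with [z H = None] all lie in [Z1 = Y :&: val H]; the coboundary
    of [w0] cancels them, and the signs of [H] separate the rest. *)
Lemma exactness Y t c : Y \in flats -> supported t c ->
  (forall y, supp y = Y -> coboundary c y = 0) ->
  exists2 w, supported t w & forall z, covers (supp z) Y -> c z = coboundary w z.
Proof.
move=> YF; have [n] := ubnP (free_signs t).
elim: n t c => // n ih t c; rewrite ltnS => le tc dc.
have [z1 /andP[cz1 nz1]|all0] :=
    pickP (fun z => covers (supp z) Y && (c z != 0)); last first.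
  exists (fun=> 0) => // z cz; rewrite [RHS]big1 => [|v _]; last exact: mul0r.
  by have := all0 z; rewrite cz => /negbFE/eqP.
have [H ZH YH] := covers_separate (supp_flat z1) cz1.
have ZF := supp_flat z1; set Z1 := supp z1 in cz1 ZH ZF.
have Z1E : Z1 = (Y :&: val H)%VS by apply: covers_cap.
have ct z : c z != 0 -> sign_le t z by apply: contraNT => /tc ->.
have z1H : z1 H = None by apply/eqP; rewrite -supp_sub_hyperplane.
have tH : t H = None.
  apply/eqP; apply: contraPT z1H => tH.
  by move/sign_leP: (ct _ nz1) => -> //; apply/eqP.
have onH z : covers (supp z) Y -> z H = None -> supp z = Z1.
  move=> cz zH; rewrite Z1E; apply: covers_cap => //.
  by rewrite supp_sub_hyperplane zH.
have yH y : supp y = Y -> y H != None by move=> sy; rewrite -supp_sub_hyperplane sy.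
(* Sum [dc] over the faces of [Y] on the positive side of [H]: faces [z] off [H] have
   both or none of their sides there, and those on [H] exactly one. *)
have flux : \sum_(z | supp z == Z1) c z = 0.
  have [e ee eP] := incidence_side k ZF YF cz1 ZH YH.
  have [e' _ sides] := incidence_side_sum k ZF YF cz1 ZH YH.
  have e0 : e != 0 by apply: contra_eq_neq ee => ->; rewrite mul0r eq_sym oner_neq0.
  apply: (mulIf e0); rewrite mul0r mulr_suml.
  transitivity (\sum_(y | (supp y == Y) && (y H == Some true)) coboundary c y);
    last first.
    by apply: big1 => y /andP[/eqP sy _]; apply: dc.
  rewrite /coboundary exchange_big /= [RHS](bigID (fun z => supp z == Z1)) /=.
  rewrite [X in _ = _ + X]big1 ?addr0 => [|z nz].
    apply: eq_bigr => z /eqP sz.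
    have [yp [ym [syp sym zyp zym [ypH ymH _]]]] := sides z sz.
    rewrite (bigD1 yp) /= ?syp ?ypH ?eqxx // big1 => [|y].
      by rewrite addr0 (eP z yp) // ypH eqxx.
    case/andP=> /andP[/eqP sy /eqP y_H] ney; rewrite /incidence.
    case: ifP => [/andP[zy _]|]; last by rewrite mulr0.
    by case/eqP: ney; apply: (side_unique cz1 ZH YH sz sy syp zy zyp); rewrite y_H.
  rewrite -mulr_sumr.
  have [cz|ncz] := boolP (covers (supp z) Y); last first.
    rewrite big1 ?mulr0 // => y /andP[/eqP sy _].
    by rewrite /incidence sy (negbTE ncz) andbF.
  have [zH|zH] := eqVneq (z H) None; first by rewrite onH ?eqxx in nz.
  have yz y : incidence z y != 0 -> y H = z H.
    by case/incidence_neq0=> /sign_leP zy _; apply: zy.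
  have [zt|zt] := eqVneq (z H) (Some true).
    rewrite -[X in _ * X]addr0 -[X in _ + X](_ :
      \sum_(y | (supp y == Y) && (y H != Some true)) incidence z y = 0).
      by rewrite -(bigID (fun y => y H == Some true)) incidence_sum0 // mulr0.
    apply: big1 => y /andP[_ y_H]; apply/eqP; apply: contraNT y_H => /yz ->.
    exact/eqP.
  rewrite big1 ?mulr0 // => y /andP[_ /eqP y_H]; apply/eqP.
  by apply: contraNT zt => /yz <-; apply/eqP.
have [w0 w0t w0E] : exists2 w, supported t w &
    forall x, supp x = Z1 -> c x = coboundary w x.
  by apply: connected_sum.
pose c' z := c z + (-1) * coboundary w0 z.
have c't : supported t c'.
  by move=> z tz; rewrite /c' tc // (supported_coboundary w0t tz) mulr0 addr0.
have c'H z : covers (supp z) Y -> z H = None -> c' z = 0.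
  by move=> cz zH; rewrite /c' w0E ?mulN1r ?subrr //; apply: onH.
have dc' y : supp y = Y -> coboundary c' y = 0.
  move=> sy; rewrite /coboundary; under eq_bigr => z _ do rewrite /c' addrC.
  by rewrite -/(coboundary _ y) coboundaryP coboundary2 mulr0 add0r dc.
have side b : exists2 w, supported (extend t H b) w &
    forall z, covers (supp z) Y -> (if z H == Some b then c' z else 0) = coboundary w z.
  apply: ih; first exact: leq_trans (free_signs_extend b tH) le.
    move=> z tz; case: eqP => // zH; apply: c't.
    by apply: contra tz => tz; apply: extend_le.
  move=> y sy; have [yb|yb] := eqVneq (y H) (Some b).
    rewrite -[RHS](dc' y sy); apply: eq_bigr => z _.
    case: (eqVneq (z H) (Some b)) => // zH.
    have [->|/incidence_neq0[/sign_leP zy cz]] := eqVneq (incidence z y) 0.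
      by rewrite !mulr0.
    rewrite c'H -?sy //; apply/eqP; apply: contraNT zH => zH.
    by rewrite -zy // yb.
  apply: big1 => z _; case: (eqVneq (z H) (Some b)) => [zH|]; last by rewrite mul0r.
  have [->|/incidence_neq0[/sign_leP zy cz]] := eqVneq (incidence z y) 0.
    by rewrite !mulr0.
  by case/eqP: yb; rewrite zy ?zH.
have [wt wtt wtE] := side true; have [wf wft wfE] := side false.
exists (fun v => w0 v + (wt v + wf v)) => [v tv|z cz].
  rewrite w0t // (supported_extend tH wtt tv) (supported_extend tH wft tv).
  by rewrite !addr0.
rewrite !coboundaryD -wtE // -wfE //.
suff -> : c z = coboundary w0 z + c' z.
  congr (_ + _); have := c'H z cz.
  by case: (z H) => [[]|] /=; rewrite ?addr0 ?add0r // => ->.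
by rewrite /c' mulN1r addrCA subrr addr0.
Qed.

End Exactness.

(** * The module of faces *)

Section FaceModule.
Context {R : realType} {d : nat} (A : arrangement R d) (k : fieldType).
Variables (M : lalgType k) (basis : face A -> M) (coef : face A -> M -> k).
Hypothesis coefP : forall y a m n, coef y (a *: m + n) = a * coef y m + coef y n.
Hypothesis coef_basis : forall x y, coef y (basis x) = (x == y)%:R.
Hypothesis basis_sum : forall m, m = \sum_x coef x m *: basis x.
Hypothesis basis1 : 1 = basis (oneface A).
Hypothesis basisM : forall x a y,
  basis x * (a *: basis y) = a *: basis (mulface x y).
Local Notation L := (intersection_lattice A).
Local Notation flats := (flats A).
Local Notation incidence := (@incidence R d A k).
Implicit Types (H K : hyperplanes A) (x y z : face A) (u v m n : M).
Implicit Types (X Y Z : L).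

Lemma coef0 y : coef y 0 = 0.
Proof.
have := coefP y 1 0 0; rewrite scaler0 addr0 mul1r => /eqP.
by rewrite -subr_eq0 opprD addrA subrr sub0r oppr_eq0 => /eqP.
Qed.

Lemma coefD y m n : coef y (m + n) = coef y m + coef y n.
Proof. by have := coefP y 1 m n; rewrite scale1r mul1r. Qed.

Lemma coefZ a m y : coef y (a *: m) = a * coef y m.
Proof. by have := coefP y a m 0; rewrite !addr0 coef0 addr0. Qed.

Lemma coef_sum (I : Type) (r : seq I) (P : pred I) (F : I -> M) y :
  coef y (\sum_(i <- r | P i) F i) = \sum_(i <- r | P i) coef y (F i).
Proof. by apply: (big_morph (coef y) _ (coef0 y)) => m n; apply: coefD. Qed.

Lemma coef_inj m n : (forall y, coef y m = coef y n) -> m = n.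
Proof.
by move=> h; rewrite (basis_sum m) (basis_sum n); apply: eq_bigr => x _; rewrite h.
Qed.

Lemma sum_delta (c : face A -> k) y : \sum_x c x * (x == y)%:R = c y.
Proof.
rewrite (bigD1 y) //= eqxx mulr1 big1 ?addr0 // => x /negbTE ->.
exact: mulr0.
Qed.

Lemma coef_comb (c : face A -> k) y : coef y (\sum_x c x *: basis x) = c y.
Proof.
rewrite coef_sum -[RHS]sum_delta; apply: eq_bigr => x _.
by rewrite coefZ coef_basis.
Qed.

Lemma exists_coef (c : face A -> k) : exists m, forall x, coef x m = c x.
Proof. by exists (\sum_x c x *: basis x) => y; rewrite coef_comb. Qed.

Lemma eq_on_basis (T : lmodType k) (f g : M -> T) : linear f -> linear g ->
  (forall x, f (basis x) = g (basis x)) -> f =1 g.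
Proof.
move=> lf lg fg m.
pose F : {linear M -> T} := HB.pack f (GRing.isLinear.Build k M T *:%R f lf).
pose G : {linear M -> T} := HB.pack g (GRing.isLinear.Build k M T *:%R g lg).
rewrite (basis_sum m); transitivity (F (\sum_x coef x m *: basis x)) => //.
transitivity (G (\sum_x coef x m *: basis x)) => //; rewrite !linear_sum.
by apply: eq_bigr => x _; rewrite !linearZ /= fg.
Qed.

Section Extension.
Variables (T : lmodType k) (F : face A -> T).

Definition lin_ext m : T := \sum_x coef x m *: F x.

Fact lin_ext_is_linear : linear lin_ext.
Proof.
move=> a u m; rewrite /lin_ext scaler_sumr -big_split; apply: eq_bigr => x _ /=.
by rewrite coefD coefZ scalerDl scalerA.
Qed.
HB.instance Definition _ := GRing.isLinear.Build k M T *:%R lin_ext lin_ext_is_linear.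

Lemma lin_ext_basis x : lin_ext (basis x) = F x.
Proof.
rewrite /lin_ext (eq_bigr (fun y => (x == y)%:R *: F y)) => [|y _].
  rewrite (bigD1 x) //= eqxx scale1r big1 ?addr0 // => y.
  by rewrite eq_sym => /negbTE ->; apply: scale0r.
by rewrite coef_basis.
Qed.

End Extension.

Definition flat_of x : L := SeqSub (codom_f (@supp R d A) x).

Lemma flat_ofE x Y : (flat_of x == Y) = (supp x == val Y).
Proof. by []. Qed.

Lemma val_flat Y : val Y \in flats. Proof. exact: ssvalP. Qed.

Fact flat_face_subproof Y : exists x, supp x = val Y.
Proof. exact: flatP (val_flat Y). Qed.
Definition flat_face Y : face A := sval (cid (flat_face_subproof Y)).

Lemma supp_flat_face Y : supp (flat_face Y) = val Y.
Proof. exact: svalP (cid (flat_face_subproof Y)). Qed.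

Definition lattice_cover Y Z := covers (val Y) (val Z).

Definition part Y : {linear M -> M} :=
  lin_ext (fun y => if flat_of y == Y then basis y else 0).

Definition diff : {linear M -> M} := lin_ext (fun z => \sum_y incidence z y *: basis y).

Lemma part_basis Y y : part Y (basis y) = if flat_of y == Y then basis y else 0.
Proof. exact: lin_ext_basis. Qed.

Lemma diff_basis z : diff (basis z) = \sum_y incidence z y *: basis y.
Proof. exact: lin_ext_basis. Qed.

Lemma coef_lin_ext (F : face A -> M) m y :
  coef y (lin_ext F m) = \sum_x coef x m * coef y (F x).
Proof. by rewrite coef_sum; apply: eq_bigr => x _; rewrite coefZ. Qed.

Lemma coef_part Y m y : coef y (part Y m) = if supp y == val Y then coef y m else 0.
Proof.
rewrite [LHS]coef_lin_ext.
rewrite -(sum_delta (fun x => if supp x == val Y then coef x m else 0)).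
apply: eq_bigr => x _; rewrite flat_ofE.
by case: ifP => _; rewrite ?coef_basis // coef0 mulr0 mul0r.
Qed.

Lemma coef_diff m y : coef y (diff m) = coboundary (fun z => coef z m) y.
Proof.
rewrite [LHS]coef_lin_ext; apply: eq_bigr => z _.
by rewrite coef_comb.
Qed.

(** The region without constraints. *)
Definition no_signs : {ffun hyperplanes A -> sign} := [ffun=> None].

Lemma supported_no_signs (c : face A -> k) : supported no_signs c.
Proof. by move=> z /negP[]; apply/sign_leP => H; rewrite ffunE eqxx. Qed.

Lemma flat_sum_part Y m : \sum_(y | supp y == val Y) (coef y (part Y m))
  = \sum_(y | supp y == val Y) coef y m.
Proof. by apply: eq_bigr => y; rewrite coef_part => ->. Qed.

Lemma flat_sum_diff Y m : \sum_(y | supp y == val Y) (coef y (diff m)) = 0.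
Proof.
under eq_bigr => y _ do rewrite coef_diff.
rewrite exchange_big big1 // => z _.
by rewrite -mulr_sumr incidence_sum0 ?mulr0 ?val_flat.
Qed.

Lemma sum_flat_face Y : \sum_(y | supp y == val Y) (y == flat_face Y)%:R = 1 :> k.
Proof.
rewrite (bigD1 (flat_face Y)) ?supp_flat_face // eqxx.
by rewrite big1 => [|y /andP[_ /negbTE ->] //]; apply: addr0.
Qed.

Lemma face_module_quadratic :
  quadratic lattice_cover part diff (fun Y => basis (flat_face Y)).
Proof.
split.
- move=> X Y m; apply/coef_inj => y; case: (eqVneq X Y) => [->|ne].
    by rewrite !coef_part; case: ifP => // ->.
  rewrite !coef_part coef0; case: eqP => // ->; case: eqP => // e.
  by case/eqP: ne; apply: val_inj.
- move=> m; apply/coef_inj => y; rewrite coef_sum.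
  rewrite (eq_bigr (fun Y => if flat_of y == Y then coef y m else 0)).
    by rewrite -big_mkcond (big_pred1 (flat_of y)).
  by move=> Y _; rewrite coef_part -flat_ofE.
- move=> X Y; rewrite part_basis.
  have -> : (flat_of (flat_face Y) == X) = (X == Y).
    by rewrite flat_ofE supp_flat_face (inj_eq val_inj) eq_sym.
  by case: eqP => // ->.
- move=> Y Z m ncov; apply/coef_inj => y; rewrite coef_part coef0.
  case: eqP => // sy; rewrite coef_diff; apply: big1 => z _; rewrite coef_part.
  case: eqP => [sz|_]; last exact: mul0r.
  by rewrite /incidence sz sy -/(lattice_cover Z Y) (negbTE ncov) andbF mulr0.
- move=> m; apply/coef_inj => y; rewrite coef_diff coef0.
  rewrite -[RHS](coboundary2 (fun z => coef z m) y).
  by apply: eq_bigr => z _; rewrite coef_diff.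
- move=> Y c dc0.
  have [|w _ wE] := exactness (val_flat Y) (supported_no_signs (fun z => coef z c)).
    move=> y sy; have := congr1 (coef y) dc0.
    by rewrite coef_part sy eqxx coef_diff coef0.
  have [m mE] := exists_coef w; exists m => Z cZY; apply/coef_inj => z.
  rewrite !coef_part; case: eqP => // sz; rewrite coef_diff wE ?sz //.
  by apply: eq_bigr => v _; rewrite mE.
- move=> Y m; pose a := \sum_(y | supp y == val Y) coef y m.
  pose c y := coef y m - a * (y == flat_face Y)%:R.
  have [|w _ wE] := connected_sum (val_flat Y) (supported_no_signs c).
    by rewrite sumrB -mulr_sumr sum_flat_face mulr1 subrr.
  have [n nE] := exists_coef w; exists a, n; apply/coef_inj => y.
  rewrite coefD coefZ !coef_part coef_basis coef_diff.
  case: eqP => sy; last first.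
    case: eqP => [e|_]; last by rewrite mulr0n mulr0 addr0.
    by case: sy; rewrite -e supp_flat_face.
  rewrite /coboundary; under eq_bigr => z _ do rewrite nE.
  by rewrite -/(coboundary w y) -wE // /c eq_sym addrC subrK.
- move=> Y a c e.
  have sumE : \sum_(y | supp y == val Y)
      coef y (a *: basis (flat_face Y) + part Y (diff c)) = a.
    rewrite (eq_bigr (fun y => a * (y == flat_face Y)%:R + coef y (part Y (diff c)))).
      rewrite big_split -mulr_sumr sum_flat_face flat_sum_part flat_sum_diff mulr1.
      exact: addr0.
    by move=> y _; rewrite coefD coefZ coef_basis eq_sym.
  by rewrite -sumE e; apply: big1 => y _; apply: coef0.
Qed.

Definition basis_act x y : M :=
  if (supp x <= supp y)%VS then basis (mulface x y) else 0.

Definition act u : {linear M -> M} :=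
  lin_ext (fun y => lin_ext (fun x => basis_act x y) u).

Lemma act_basis x y : act (basis x) (basis y) = basis_act x y.
Proof. by rewrite [LHS]lin_ext_basis lin_ext_basis. Qed.

Lemma actP a u v m : act (a *: u + v) m = a *: act u m + act v m.
Proof.
rewrite /act /= /lin_ext scaler_sumr -big_split; apply: eq_bigr => x _ /=.
rewrite -[X in _ *: X]/(lin_ext _ (a *: u + v)) linearP scalerDr /=.
by rewrite !scalerA [a * _]mulrC.
Qed.

Lemma basis_mul x y : basis x * basis y = basis (mulface x y).
Proof. by rewrite -[basis y]scale1r basisM scale1r. Qed.

Lemma mul_linear x : linear (fun u => basis x * u).
Proof.
have mulE u : basis x * u = \sum_y coef y u *: basis (mulface x y).
  by rewrite {1}(basis_sum u) mulr_sumr; apply: eq_bigr => y _; rewrite basisM.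
move=> a u v /=; rewrite !mulE scaler_sumr -big_split; apply: eq_bigr => y _ /=.
by rewrite coefP scalerDl scalerA.
Qed.

(** [supp (x y)] is the join of [supp x] and [supp y]. *)
Lemma basis_act_assoc x y z :
  act (basis (mulface x y)) (basis z) = act (basis x) (act (basis y) (basis z)).
Proof.
rewrite !act_basis /basis_act; case: ifP => [/supp_subP xyz|xyz].
  have yz : (supp y <= supp z)%VS.
    apply/supp_subP => H /xyz; rewrite mulfaceE; case: eqP => // *; congruence.
  have xz : (supp x <= supp z)%VS.
    by apply/supp_subP => H /xyz; rewrite mulfaceE; case: eqP => // -> .
  by rewrite yz act_basis /basis_act supp_mull // xz mulfaceA.
case: ifP => yz; last by rewrite linear0.
rewrite act_basis /basis_act supp_mull //; case: ifP => // xz.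
case/negP: xyz; apply/supp_subP => H zH; rewrite mulfaceE.
by rewrite (supp_subP _ _ xz H zH) (supp_subP _ _ yz H zH).
Qed.

Lemma act1 m : act 1 m = m.
Proof.
rewrite basis1; apply: eq_on_basis m => [a u v|//|y]; first exact: linearP.
rewrite act_basis /basis_act mul1face; case: ifP => // /negP[].
by apply/supp_subP => H _; rewrite ffunE.
Qed.

Lemma actM u v m : act (u * v) m = act u (act v m).
Proof.
apply: (eq_on_basis (f := fun u => act (u * v) m) (g := fun u => act u (act v m))) u.
- by move=> a u u'; rewrite mulrDl -scalerAl actP.
- by move=> a u u'; rewrite actP.
move=> x; apply: (eq_on_basis (f := fun v => act (basis x * v) m)
  (g := fun v => act (basis x) (act v m))) v.
- by move=> a v v'; rewrite mul_linear actP.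
- by move=> a v v'; rewrite actP linearP.
move=> y; apply: (eq_on_basis (f := fun m => act (basis x * basis y) m)
  (g := fun m => act (basis x) (act (basis y) m))) m.
- by move=> a m m'; rewrite linearP.
- by move=> a m m'; rewrite !linearP.
by move=> z; rewrite basis_mul basis_act_assoc.
Qed.

Lemma act_commutes (F : {linear M -> M}) :
  (forall x y, act (basis x) (F (basis y)) = F (act (basis x) (basis y))) ->
  forall u m, act u (F m) = F (act u m).
Proof.
move=> h u m.
apply: (eq_on_basis (f := fun u => act u (F m)) (g := fun u => F (act u m))) u.
- by move=> a u u'; rewrite actP.
- by move=> a u u'; rewrite actP linearP.
move=> x; apply: (eq_on_basis (f := fun m => act (basis x) (F m))
  (g := fun m => F (act (basis x) m))) m => //.
- by move=> a m m'; rewrite !linearP.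
- by move=> a m m'; rewrite !linearP.
Qed.

Lemma act_part u Y m : act u (part Y m) = part Y (act u m).
Proof.
apply: act_commutes => x y; rewrite act_basis part_basis /basis_act.
case: ifP => sy; rewrite ?act_basis /basis_act; case: ifP => xy; rewrite ?linear0 //.
  by rewrite part_basis flat_ofE supp_mull // -flat_ofE sy.
by rewrite part_basis flat_ofE supp_mull // -flat_ofE sy.
Qed.

(** Compare the components in a flat [Y] that covers [supp z].  If [supp x] is in
    [supp z], multiplication by [x] sends the two sides of [z] to those of [x z].
    If it is in [Y] only, both sides of [z] are sent to the same face. *)
Lemma act_diff u m : act u (diff m) = diff (act u m).
Proof.
apply: act_commutes => x z; rewrite act_basis diff_basis.
have by_flat (F : face A -> M) :
    \sum_y F y = \sum_(Y : L) \sum_(y | supp y == val Y) F y.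
  by rewrite (partition_big flat_of predT).
have -> : act (basis x) (\sum_y incidence z y *: basis y) =
    \sum_y incidence z y *: basis_act x y.
  by rewrite linear_sum; apply: eq_bigr => y _; rewrite linearZ /= act_basis.
transitivity (\sum_y if (supp x <= supp z)%VS
    then incidence (mulface x z) y *: basis y else 0); last first.
  rewrite /basis_act; case: ifP => _; last by rewrite big1 ?linear0.
  by rewrite diff_basis.
rewrite !by_flat; apply: eq_bigr => Y _.
have [cZY|ncZY] := boolP (covers (supp z) (val Y)); last first.
  rewrite !big1 // => y /eqP sy; first case: ifP => // xz.
    by rewrite /incidence supp_mull // sy (negbTE ncZY) andbF scale0r.
  by rewrite /incidence sy (negbTE ncZY) andbF scale0r.
have [H ZH YH] := covers_separate (supp_flat z) cZY.
have [e _ sides] := incidence_side_sum k (supp_flat z) (val_flat Y) cZY ZH YH.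
have [yp [ym [syp sym zyp zym [ypH ymH ->]]]] := sides z erefl.
rewrite /basis_act syp sym.
have [xz|xz] := boolP (supp x <= supp z)%VS.
  have xY := subv_trans xz (covers_sub cZY); rewrite xY.
  have sxz := supp_mull xz.
  have [yp' [ym' [syp' sym' zyp' zym' [ypH' ymH' ->]]]] := sides _ sxz.
  have xH : x H = None by apply/eqP; rewrite -supp_sub_hyperplane (subv_trans xz).
  have le_mul y : sign_le z y -> sign_le (mulface x z) (mulface x y).
    move=> /sign_leP zy; apply/sign_leP => K; rewrite !mulfaceE.
    by case: ifP => // _; apply: zy.
  have mul_side y y' : supp y = val Y -> sign_le z y -> supp y' = val Y ->
      sign_le (mulface x z) y' -> y H = y' H -> mulface x y = y'.
    move=> sy zy sy' zy' yy'; apply: (side_unique cZY ZH YH sxz) => //.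
    - by rewrite supp_mull sy.
    - exact: le_mul.
    - by rewrite mulfaceE xH.
  by rewrite (mul_side yp yp') ?ypH // (mul_side ym ym') ?ymH.
rewrite big1 //; case: ifP => xY; last by rewrite subrr scaler0.
rewrite (_ : mulface x yp = mulface x ym) ?subrr ?scaler0 //.
apply: face_eqP => K; rewrite !mulfaceE; case: eqP => // xK.
have [zK|zK] := eqVneq (z K) None; last first.
  by move/sign_leP: zyp => -> //; move/sign_leP: zym => ->.
have [YK|YK] := boolP (val Y <= val K)%VS.
  have := YK; rewrite -syp supp_sub_hyperplane => /eqP ->.
  by have := YK; rewrite -sym supp_sub_hyperplane => /eqP ->.
case/negP: xz; rewrite (covers_cap cZY _ YK) ?supp_sub_hyperplane ?zK //.
by rewrite subv_cap xY supp_sub_hyperplane xK.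
Qed.

Definition act_gens u := act u (\sum_Y basis (flat_face Y)).

Lemma act_gens_linear : linear act_gens.
Proof. by move=> a u v; apply: actP. Qed.

(** The contribution of the flat [supp x] is [x] itself, and those of the other
    flats have larger supports. *)
Lemma act_gens_triangular x w : coef w (act_gens (basis x)) != (x == w)%:R ->
  (\dim (supp x) < \dim (supp w))%N.
Proof.
have -> : coef w (act_gens (basis x)) = \sum_Y coef w (basis_act x (flat_face Y)).
  by rewrite /act_gens linear_sum coef_sum; apply: eq_bigr => Y _; rewrite act_basis.
have coef_act Y : coef w (basis_act x (flat_face Y)) != 0 ->
    (supp x <= val Y)%VS /\ w = mulface x (flat_face Y).
  rewrite /basis_act supp_flat_face; case: ifP => [xY|_]; last by rewrite coef0 eqxx.
  rewrite coef_basis; case: (eqVneq (mulface x (flat_face Y)) w) => [->//|_].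
  by rewrite eqxx.
rewrite ltnNge => ne; apply/negP => ledim; move/eqP: ne; apply.
have big0 : \sum_(Y | Y != flat_of x) coef w (basis_act x (flat_face Y)) = 0.
  apply: big1 => Y neY; apply/eqP; apply: contraT => /coef_act[xY wE].
  move: ledim; rewrite wE supp_mull ?supp_flat_face //.
  rewrite (geq_leqif (dimv_leqif_sup xY)) => Yx; case/eqP: neY.
  by apply: val_inj; apply/eqP; rewrite eqEsubv Yx.
rewrite (bigD1 (flat_of x)) // big0 /basis_act supp_flat_face subvv.
have -> : mulface x (flat_face (flat_of x)) = x.
  apply: face_eqP => K; rewrite mulfaceE; case: eqP => // xK.
  have /supp_eqP/(_ K) := supp_flat_face (flat_of x).
  by rewrite xK eqxx => /eqP.
by rewrite coef_basis; apply: addr0.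
Qed.

Lemma act_gens_inj u : act_gens u = 0 -> u = 0.
Proof.
move=> u0; apply: coef_inj => w; rewrite coef0.
have [n] := ubnP (\dim (supp w)); elim: n w => // n ih w; rewrite ltnS => le.
have : coef w (act_gens u) = \sum_x coef x u * (x == w)%:R.
  have lE := act_gens_linear.
  pose F : {linear M -> M} :=
    HB.pack act_gens (GRing.isLinear.Build k M M *:%R act_gens lE).
  rewrite {1}(basis_sum u) -[act_gens _]/(F _) linear_sum coef_sum.
  apply: eq_bigr => x _; rewrite linearZ coefZ /=.
  have [->//|/act_gens_triangular lt] :=
    eqVneq (coef w (act_gens (basis x))) (x == w)%:R.
  by rewrite ih ?mul0r // (leq_trans lt).
by rewrite u0 coef0 sum_delta.
Qed.

Lemma act_gens_surj m : exists u, act_gens u = m.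
Proof.
have lin (a : k) u v m1 m2 : act_gens u = m1 -> act_gens v = m2 ->
    act_gens (a *: u + v) = a *: m1 + m2.
  by move=> <- <-; apply: act_gens_linear.
have act0 : act_gens 0 = 0.
  by have := lin (-1) 0 0 _ _ erefl erefl; rewrite scaler0 addr0 scaleN1r addNr.
have comb (c : face A -> k) : (forall x, c x != 0 -> exists u, act_gens u = basis x) ->
    exists u, act_gens u = \sum_x c x *: basis x.
  move=> h; apply: (big_ind (fun m => exists u, act_gens u = m)).
  - by exists 0.
  - move=> _ _ [u <-] [v <-]; exists (u + v).
    by have := act_gens_linear 1 u v; rewrite !scale1r.
  - move=> x _; have [->|/h[u uE]] := eqVneq (c x) 0.
      by exists 0; rewrite scale0r.
    by exists (c x *: u); have := lin (c x) u 0 _ _ uE act0; rewrite !addr0.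
suff all_basis x : exists u, act_gens u = basis x.
  by rewrite (basis_sum m); apply: comb.
have [n] := ubnP (d - \dim (supp x)); elim: n x => // n ih x; rewrite ltnS => le.
have [|u uE] := comb (fun w => coef w (act_gens (basis x)) - (x == w)%:R).
  move=> w; rewrite subr_eq0 => /act_gens_triangular lt; apply: ih.
  apply: leq_trans le; apply: ltn_sub2l => //; apply: leq_trans lt _.
  by rewrite (leq_trans (dimvS (subvf _))) // dimvf /dim /= mul1n.
exists ((-1) *: u + basis x); rewrite (lin _ _ _ _ _ uE erefl).
apply: coef_inj => w; rewrite coefP coef_comb coef_basis.
by rewrite mulN1r opprB subrK.
Qed.

Lemma act_gens_bij : bijective act_gens.
Proof.
have [g gE] := choice act_gens_surj.
exists g => // u; apply/esym/subr0_eq/act_gens_inj.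
have := act_gens_linear (-1) (g (act_gens u)) u.
by rewrite gE !scaleN1r addNr addrC.
Qed.

Lemma face_quadratic_module : quadratic_module lattice_cover M M.
Proof.
apply: (QuadraticModule face_module_quadratic (qm_act := act)).
- exact: actP.
- exact: act1.
- exact: actM.
- exact: act_part.
- exact: act_diff.
- exact: act_gens_bij.
Qed.

End FaceModule.

Lemma face_algebra_quadratic (k : fieldType) (R : realType) (d : nat)
    (A : arrangement R d) :
  quadratic_module (@lattice_cover R d A) {malg k[face A]} {malg k[face A]}.
Proof.
pose basis (x : face A) : {malg k[face A]} := << x >>.
pose coef (y : face A) (m : {malg k[face A]}) : k := m@_y.
have coef_basis x y : coef y (basis x) = (x == y)%:R by exact: mcoeffU1.
have coefD y m n : coef y (m + n) = coef y m + coef y n by exact: mcoeffD.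
have coefZ y a m : coef y (a *: m) = a * coef y m by exact: mcoeffZ.
have scale_basis (a : k) y : a *: basis y = << a *g y >>.
  apply/malgP => z; have := coefZ z a (basis y).
  by rewrite coef_basis /coef => ->; rewrite mcoeffU mulr_natr.
apply: (@face_quadratic_module R d A k _ basis coef) => //.
- by move=> y a m n; rewrite coefD coefZ.
- move=> m; apply/malgP => y.
  rewrite -[LHS]/(coef y m) -[RHS]/(coef y _).
  rewrite (big_morph (coef y) (coefD y) (mcoeff0 y)).
  rewrite (eq_bigr (fun x => coef x m * (x == y)%:R)) => [|x _].
    by rewrite sum_delta.
  by rewrite coefZ coef_basis.
- move=> x a y; rewrite !scale_basis [LHS]malgM_def [LHS]fgmulUU mul1r //.
Qed.

Theorem corollary8p6 (k : fieldType) (R : realType) (d d' : nat)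
    (A : arrangement R d) (A' : arrangement R d') :
  lattice_isomorphic A A' ->
  algebra_isomorphic {malg k[face A]} {malg k[face A']}.
Proof.
case=> phi bij_phi le_phi.
have [psi phiK psiK] := bij_phi.
have coverE (X Y : intersection_lattice A) :
    lattice_cover (phi X) (phi Y) = lattice_cover X Y.
  have r' := covers_flatP (val_flat (phi X)) (val_flat (phi Y)).
  have r := covers_flatP (val_flat X) (val_flat Y).
  apply/r'/r => -[XY neXY h].
  - rewrite -le_phi; split=> //.
      by move=> e; apply: neXY; rewrite (val_inj e).
    move=> Z ZF XZ ZY; pose Z' : intersection_lattice A := SeqSub ZF.
    have [||e|e] := h (val (phi Z')) (val_flat _); rewrite ?le_phi //.
      by left; rewrite -[Z]/(val Z') -[Z']phiK (val_inj e) phiK.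
    by right; rewrite -[Z]/(val Z') -[Z']phiK (val_inj e) phiK.
  - rewrite le_phi; split=> //.
      by move=> e; apply: neXY; rewrite -[X]phiK -[Y]phiK (val_inj e).
    move=> Z ZF XZ ZY; pose Z' : intersection_lattice A' := SeqSub ZF.
    have ZE : Z = val (phi (psi Z')) by rewrite psiK.
    have [||e|e] := h (val (psi Z')) (val_flat _); rewrite -?le_phi -?ZE //.
      by left; rewrite ZE (val_inj e).
    by right; rewrite ZE (val_inj e).
have rk_cover (X Y : intersection_lattice A) :
    lattice_cover X Y -> (\dim (val X) < \dim (val Y))%N.
  by move=> /covers_dim ->.
exact: (quadratic_module_iso rk_cover (face_algebra_quadratic k A)
  (quadratic_module_reindex bij_phi coverE (face_algebra_quadratic k A'))).
Qed.
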